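(* Let $m:\mathbb{R}^2\to\mathbb{C}$ be a function that is smooth on $\mathbb{R}^2\setminus\{0\}$, homogeneous in the sense that $m(\lambda s,\lambda t)=m(s,t)$ for all $s,t\in\mathbb{R}$ and $\lambda>0$, satisfies $$m(s,t)=\frac{s}{s-t},\qquad s\in\mathbb{R}_{>0},\ t\in\mathbb{R}_{<0},$$ and is regulated at $0$, meaning that $m(0)=\pi^{-1}r^{-2}\int_{\|(t_1,t_2)\|_2\le r}m(t_1,t_2)\,dt_1dt_2$ for $r>0$. Let $1<p_1,p_2<\infty$ be such that $\frac1{p_1}+\frac1{p_2}=1$. There exists an absolute constant $C>0$ such that for every integer $N\ge1$ $$\|T_m^{(N)}:L_{p_1}(\mathbb{R},S_{p_1}^N)\times L_{p_2}(\mathbb{R},S_{p_2}^N)\to L_1(\mathbb{R},S_1^N)\|>C\log(N).$$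
   Context: $S_q^N=S_q(\mathbb{C}^N)$ is the space of $N\times N$ complex matrices with the Schatten $q$-norm $\mathrm{Tr}(|x|^q)^{1/q}$, and $L_q(\mathbb{R},S_q^N)$ is the Bochner $L_q$-space with respect to Lebesgue measure. The bilinear map $T_m^{(N)}$ is determined by $$T_m^{(N)}(f_1,f_2)(s)=\int_{\mathbb{R}}\int_{\mathbb{R}}\widehat{f_1}(\xi_1)\widehat{f_2}(\xi_2)\,m(\xi_1,\xi_2)\,e^{is(\xi_1+\xi_2)}\,d\xi_1d\xi_2,\qquad s\in\mathbb{R},$$ where $f_i\in L_{p_i}(\mathbb{R},S_{p_i}^N)$ have Fourier transforms $\widehat{f_i}:\mathbb{R}\to S_{p_i}^N$ that are continuous and compactly supported; the product $\widehat{f_1}(\xi_1)\widehat{f_2}(\xi_2)$ is the matrix product, and the Fourier transform is normalised so that $f(s)=\int_{\mathbb{R}}\widehat f(\xi)e^{is\xi}\,d\xi$. The norm in the claim is the bilinear operator norm, i.e. the supremum (in $[0,\infty]$) of $\|T_m^{(N)}(f_1,f_2)\|_{L_1(\mathbb{R},S_1^N)}$ over such $f_i$ with $\|f_i\|_{L_{p_i}(\mathbb{R},S_{p_i}^N)}\le1$. ''Absolute constant'' means that $C$ does not depend on $N$, $p_1$, $p_2$ or $m$. By homogeneity the right-hand side of the condition at $0$ does not depend on $r$. *)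

(* Defs.v *)
From mathcomp Require Import all_boot all_order all_algebra.
From mathcomp Require Import all_classical all_reals all_analysis.
From mathcomp Require Export complex.

Set Implicit Arguments.
Unset Strict Implicit.
Unset Printing Implicit Defensive.

Import Order.TTheory GRing.Theory Num.Theory.
Import numFieldNormedType.Exports.

Local Open Scope classical_set_scope.
Local Open Scope ring_scope.
Local Open Scope complex_scope.
Local Open Scope sesquilinear_scope.

Local Notation Re := complex.Re.
Local Notation Im := complex.Im.

Section Schatten.
Context {R : realType}.

(* Borel functional calculus of a Hermitian matrix A; the eigenvalues, as
   listed by spectral_diag, are then real. *)
Definition hermfun N (phi : R -> R) (A : 'M[R[i]]_N) : 'M[R[i]]_N :=
  invmx (spectralmx A) *m
  diag_mx (map_mx (fun z => (phi (Re z))%:C) (spectral_diag A)) *m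
  spectralmx A.

Definition mxabs N (A : 'M[R[i]]_N) : 'M[R[i]]_N :=
  hermfun Num.sqrt (A^t* *m A).

Definition schatten N (q : R) (A : 'M[R[i]]_N) : R :=
  (Re (\tr (hermfun (fun x => x `^ q) (mxabs A)))) `^ q^-1.

End Schatten.

Section Integration.
Context {R : realType}.

Definition cintegral d (T : measurableType d) (mu : {measure set T -> \bar R})
    (D : set T) (f : T -> R[i]) : R[i] :=
  (\int[mu]_(x in D) Re (f x)) +i* (\int[mu]_(x in D) Im (f x)).

(* In finite dimension the Bochner integral is computed entrywise, and strong
   measurability is measurability of the entries. *)
Definition mxintegral N (f : R -> 'M[R[i]]_N) : 'M[R[i]]_N :=
  \matrix_(i, j) cintegral lebesgue_measure setT (fun x => f x i j).

Definition mxmeasurable N (f : R -> 'M[R[i]]_N) : Prop :=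
  forall i j, measurable_fun setT (fun x : R => Re (f x i j)) /\
              measurable_fun setT (fun x : R => Im (f x i j)).

Definition mxcontinuous N (f : R -> 'M[R[i]]_N) : Prop :=
  forall i j, continuous (fun x : R => Re (f x i j)) /\
              continuous (fun x : R => Im (f x i j)).

Definition bochner_norm N (q : R) (f : R -> 'M[R[i]]_N) : \bar R :=
  Lnorm lebesgue_measure q%:E (fun s : R => (schatten q (f s))%:E).

Definition bochner_Lp N (q : R) (f : R -> 'M[R[i]]_N) : Prop :=
  mxmeasurable f /\ (bochner_norm q f < +oo)%E.

Definition expi (x : R) : R[i] := cos x +i* sin x.

(* g is a continuous, compactly supported Fourier transform of f, with the
   normalisation f(s) = \int g(xi) e^{i s xi} dxi. As f need not be integrable,
   its transform is characterised by inversion; f is an L_q class, hence the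
   equality almost everywhere. *)
Definition cc_fourier N (f g : R -> 'M[R[i]]_N) : Prop :=
  [/\ mxcontinuous g,
      compact (closure [set xi : R | g xi != 0]) &
      {ae lebesgue_measure, forall s : R,
        f s = mxintegral (fun xi => expi (s * xi) *: g xi)}].

End Integration.

Section Symbol.
Context {R : realType}.

Definition partial (b : bool) (h : R * R -> R) : R * R -> R :=
  fun x => 'D_(if b then (0, 1) else (1, 0)) h x.

Definition smooth_on (A : set (R * R)) (h : R * R -> R) : Prop :=
  forall (s : seq bool) (x : R * R), A x ->
    {for x, continuous (foldr partial h s)} /\
    forall b : bool,
      derivable (foldr partial h s) x (if b then (0, 1) else (1, 0)).

Definition csmooth_on (A : set (R * R)) (m : R * R -> R[i]) : Prop :=
  smooth_on A (fun x => Re (m x)) /\ smooth_on A (fun x => Im (m x)).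

Definition homogeneous0 (m : R * R -> R[i]) : Prop :=
  forall l s t : R, 0 < l -> m (l * s, l * t) = m (s, t).

Definition disk (r : R) : set (R * R) :=
  [set x | Num.sqrt (x.1 ^+ 2 + x.2 ^+ 2) <= r].

Definition regulated0 (m : R * R -> R[i]) : Prop :=
  forall r : R, 0 < r ->
    m (0, 0) = (pi^-1 * r ^- 2)%:C *
      cintegral (lebesgue_measure \x lebesgue_measure)%E (disk r) m.

End Symbol.

Section Multiplier.
Context {R : realType}.

(* The value of T_m^(N)(f1, f2) at s, where gk is the Fourier transform of
   fk. *)
Definition bilinear_mult N (m : R * R -> R[i]) (g1 g2 : R -> 'M[R[i]]_N)
    (s : R) : 'M[R[i]]_N :=
  mxintegral (fun xi2 => mxintegral (fun xi1 =>
    (m (xi1, xi2) * expi (s * (xi1 + xi2))) *: (g1 xi1 *m g2 xi2))).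

Definition bilinear_mult_norm (N : nat) (p1 p2 : R) (m : R * R -> R[i]) :
    \bar R :=
  ereal_sup [set y | exists f1 f2 g1 g2 : R -> 'M[R[i]]_N,
    [/\ bochner_Lp p1 f1 /\ bochner_Lp p2 f2,
        cc_fourier f1 g1 /\ cc_fourier f2 g2,
        (bochner_norm p1 f1 <= 1)%E /\ (bochner_norm p2 f2 <= 1)%E &
        y = bochner_norm 1 (bilinear_mult m g1 g2)]].

End Multiplier.

(* Main.v *)
Require Import Defs.
From mathcomp Require Import all_boot all_order all_algebra.
From mathcomp Require Import all_classical all_reals all_analysis.
From mathcomp Require Import measurable_realfun zify ring lra.

Set Implicit Arguments.
Unset Strict Implicit.
Unset Printing Implicit Defensive.

Import Order.TTheory GRing.Theory Num.Theory.
Import numFieldNormedType.Exports.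
Local Open Scope classical_set_scope.
Local Open Scope ring_scope.
Local Open Scope complex_scope.
Local Open Scope sesquilinear_scope.

Local Notation Re := complex.Re.
Local Notation Im := complex.Im.

(* Let phi be the triangle function and F >= 0 its transform, a Fejer kernel.
   Put f1 = F(s) sum_j e^{i s a_j} E_{j,0} and
   f2 = F(s) sum_k e^{-i s b_k} E_{0,k} with a_j, b_k > 1, so that the
   transforms consist of translates of phi placed where m(s,t) = s/(s-t).
   Both f1(s) and f2(s) have rank one, hence their Schatten norms equal
   sqrt(N) F(s) for every exponent; as 0 <= F <= 1 and F is integrable, the
   L_p norms are at most an absolute constant times sqrt(N), whatever p > 1.
   If b_0 << a_0 << b_1 << a_1 << ..., then m(a_j, -b_k) is close to 1 for
   k <= j and to 0 otherwise, so up to diagonal unitaries T_m(f1,f2)(s) is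
   close to F(s)^2 times the lower triangular matrix of ones. Pairing it with
   the matrix 1/(j-k+1/2), bounded on l^2 by Hilbert's inequality, bounds its
   trace norm from below by a multiple of N log N, against the product N of
   the two norms. *)

(** * Schatten norms *)

Section SchattenTheory.
Context {R : realType}.
Implicit Types (N : nat) (q : R).

Lemma mxtrace_hermfun N (phi : R -> R) (A : 'M[R[i]]_N) :
  \tr (hermfun phi A) = \sum_i (phi (Re (spectral_diag A 0 i)))%:C.
Proof.
rewrite /hermfun mxtrace_mulC mulmxA mulmxV ?spectral_unit// mul1mx.
by rewrite mxtrace_diag; apply: eq_bigr => i _; rewrite mxE.
Qed.

Lemma gram_normal N (S : 'M[R[i]]_N) : S^t* *m S \is normalmx.
Proof. by apply/normalmxP; rewrite trmx_mul map_mxM /= trmxCK. Qed.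

Lemma gram_spectralE N (A : 'M[R[i]]_N) : A \is normalmx ->
  A = (spectralmx A)^t* *m diag_mx (spectral_diag A) *m spectralmx A.
Proof.
move=> nA; rewrite {1}(orthomx_spectralP nA).
by rewrite invmx_unitary ?spectral_unitarymx.
Qed.

Lemma spectral_diagE N (A : 'M[R[i]]_N) : A \is normalmx ->
  diag_mx (spectral_diag A) = spectralmx A *m A *m (spectralmx A)^t*.
Proof.
move=> nA; rewrite {3}(gram_spectralE nA) !mulmxA.
have /unitarymxP U := spectral_unitarymx A.
by rewrite -!mulmxA U mulmx1 !mulmxA U mul1mx.
Qed.

(** Conjugating by the spectral matrix [P] turns [S^t* *m S] into the Gram matrix of [S *m P^t*],
    whose diagonal entries are squared column norms. Hence the eigenvalues are nonnegative, and each
    is the squared length of the image of an eigenvector. *)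
Lemma gram_spectral_diagE N (S : 'M[R[i]]_N) i :
  let A := S^t* *m S in
  spectral_diag A 0 i = \sum_k `|(S *m (spectralmx A)^t*) k i| ^+ 2.
Proof.
move=> A; have := spectral_diagE (gram_normal S).
rewrite -/A {2}/A => /matrixP/(_ i i); rewrite mxE eqxx mulr1n => ->.
rewrite !mulmxA -mulmxA.
have -> : spectralmx A *m S^t* = (S *m (spectralmx A)^t*)^t*.
  by rewrite trmx_mul map_mxM /= trmxCK.
rewrite mxE; apply: eq_bigr => k _.
by rewrite !mxE normCK mulrC.
Qed.

Lemma gram_spectral_diag_ge0 N (S : 'M[R[i]]_N) i :
  0 <= spectral_diag (S^t* *m S) 0 i.
Proof. by rewrite gram_spectral_diagE sumr_ge0// => k _; rewrite exprn_ge0. Qed.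

Lemma gram_spectral_diag_Re N (S : 'M[R[i]]_N) i :
  (Re (spectral_diag (S^t* *m S) 0 i))%:C = spectral_diag (S^t* *m S) 0 i.
Proof. by apply/RRe_real/ger0_real/gram_spectral_diag_ge0. Qed.

(** Only the values of [phi] on the spectrum enter, so it suffices that [phi] acts there as
    multiplication by [k]. This evaluates the functional calculus without knowledge of the chosen
    eigenbasis. *)
Lemma hermfun_linear N (phi : R -> R) (k : R[i]) (A : 'M[R[i]]_N) :
  A \is normalmx ->
  (forall i, (phi (Re (spectral_diag A 0 i)))%:C = k * spectral_diag A 0 i) ->
  hermfun phi A = k *: A.
Proof.
move=> nA phiE; rewrite {2}(orthomx_spectralP nA) /hermfun.
rewrite scalemxAl scalemxAr -linearZ /=; congr (_ *m diag_mx _ *m _).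
by apply/rowP => i; rewrite !mxE phiE.
Qed.

Lemma spectral_diag_quadratic N (c : R) (A : 'M[R[i]]_N) i : A \is normalmx ->
  A *m A = c%:C *: A ->
  spectral_diag A 0 i = 0 \/ spectral_diag A 0 i = c%:C.
Proof.
move=> nA AA; set d := spectral_diag A.
have dd : diag_mx d *m diag_mx d = c%:C *: diag_mx d.
  rewrite /d spectral_diagE// !mulmxA mulmxKtV ?spectral_unitarymx//.
  by rewrite -[_ *m A *m A]mulmxA AA -scalemxAr -scalemxAl.
have /matrixP/(_ i i) := dd.
rewrite mulmx_diag !mxE eqxx !mulr1n => /eqP.
rewrite -subr_eq0 -mulrBl mulf_eq0 subr_eq0 => /orP[]/eqP ->; by [right|left].
Qed.

Lemma schatten_rank1 N q (c : R) (B : 'M[R[i]]_N) : q != 0 -> 0 <= c ->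
  (B^t* *m B) *m (B^t* *m B) = c%:C *: (B^t* *m B) ->
  \tr (B^t* *m B) = c%:C ->
  schatten q B = Num.sqrt c.
Proof.
move=> q0 c0 BB trB; set A0 := B^t* *m B in BB trB *.
set t := Num.sqrt c; have t0 : 0 <= t by apply: sqrtr_ge0.
have tt : t ^+ 2 = c by rewrite sqr_sqrtr.
have absE : mxabs B = (t^-1)%:C *: A0.
  apply: hermfun_linear; first exact: gram_normal.
  move=> i; have [|] := spectral_diag_quadratic i (gram_normal B) BB => -> /=.
    by rewrite sqrtr0 mulr0.
  rewrite -/t -rmorphM /= -tt; have [->|tn0] := eqVneq t 0.
    by rewrite invr0 mul0r.
  by congr _%:C; rewrite expr2 mulKf.
have nA : (t^-1)%:C *: A0 \is normalmx.
  apply/normalmxP; rewrite linearZ /= map_mxZ /= !(=^~scalemxAl, =^~scalemxAr).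
  have /normalmxP nA0 := gram_normal B.
  by rewrite nA0 scalerA mulrC -scalerA.
have AA : ((t^-1)%:C *: A0) *m ((t^-1)%:C *: A0) = t%:C *: ((t^-1)%:C *: A0).
  rewrite -scalemxAl -scalemxAr BB !scalerA; congr (_ *: _).
  rewrite -!rmorphM /= -tt; have [->|tn0] := eqVneq t 0.
    by rewrite invr0 !mul0r.
  by congr _%:C; field.
rewrite /schatten absE.
rewrite (@hermfun_linear _ _ (t `^ q / t)%:C)//; last first.
  move=> i; have [|] := spectral_diag_quadratic i nA AA => -> /=.
    by rewrite powR0// mulr0.
  rewrite -rmorphM /=; have [->|tn0] := eqVneq t 0.
    by rewrite powR0// !mul0r.
  by rewrite mulfVK.
rewrite !linearZ /= trB -!rmorphM /= -tt.
have [->|tn0] := eqVneq t 0.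
  by rewrite expr0n/= !mulr0 powR0// invr_eq0.
have -> : t `^ q / t * (t^-1 * t ^+ 2) = t `^ q.
  by rewrite expr2 mulKf// mulfVK.
by rewrite -powRrM mulfV// powRr1.
Qed.

Lemma schatten1E N (B : 'M[R[i]]_N) :
  schatten 1 B = \sum_i Num.sqrt (Re (spectral_diag (B^t* *m B) 0 i)).
Proof.
set A := B^t* *m B; set d := spectral_diag A.
set S : 'M[R[i]]_N := diag_mx
  (map_mx (fun z => (Num.sqrt (Num.sqrt (Re z)))%:C) d) *m spectralmx A.
have absE : mxabs B = S^t* *m S.
  rewrite /S trmx_mul map_mxM /= !mulmxA -[_ *m _ *m diag_mx _]mulmxA.
  rewrite tr_diag_mx map_diag_mx mulmx_diag /mxabs /hermfun -/A -/d.
  rewrite invmx_unitary ?spectral_unitarymx//.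
  congr (_ *m diag_mx _ *m _); apply/rowP => i; rewrite !mxE /=.
  rewrite conj_Creal ?complex_real // -rmorphM /= -expr2 sqr_sqrtr ?sqrtr_ge0//.
have trE : \tr (mxabs B) = (\sum_i Num.sqrt (Re (d 0 i)))%:C.
  by rewrite mxtrace_hermfun rmorph_sum.
rewrite /schatten invr1 [hermfun _ _](_ : _ = mxabs B); last first.
  rewrite absE (@hermfun_linear _ _ 1) ?scale1r ?gram_normal// => i.
  rewrite powRr1 ?gram_spectral_diag_Re ?mul1r//.
  by have := gram_spectral_diag_ge0 S i; rewrite lecE => /andP[].
by rewrite trE /= powRr1// sumr_ge0// => i _; rewrite sqrtr_ge0.
Qed.

(* In an orthonormal eigenbasis (v_i) of B^* B, the trace is the sum of the
   <v_i, V B v_i>, and |B v_i| is the i-th singular value of B. *)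
Lemma norm_mxtrace_schatten1 N (beta : R) (B V : 'M[R[i]]_N) : 0 <= beta ->
  (forall x : 'cV[R[i]]_N, \sum_i `|(V *m x) i 0| ^+ 2 <=
     (beta ^+ 2)%:C * \sum_i `|x i 0| ^+ 2) ->
  `|\tr (B *m V)| <= (beta * schatten 1 B)%:C.
Proof.
move=> b0 Vb; set A := B^t* *m B; set P := spectralmx A.
have /unitarymxP PP : P \is unitarymx := spectral_unitarymx A.
have P'P : P^t* *m P = 1%:M.
  have /unitarymxP := spectral_unitarymx A.
  by rewrite -/P => /mulmx1C.
have -> : \tr (B *m V) = \tr (P *m (V *m (B *m P^t*))).
  rewrite [RHS]mxtrace_mulC -!mulmxA P'P mulmx1.
  exact: mxtrace_mulC.
rewrite schatten1E mulr_sumr rmorph_sum /=.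
apply: le_trans (ler_norm_sum _ _ _) _; apply: ler_sum => i _.
rewrite -(ler_pXn2r (n := 2)) ?nnegrE//; last first.
  by rewrite ler0c mulr_ge0// sqrtr_ge0.
have dge0 := gram_spectral_diag_ge0 B i.
have dge0' : 0 <= Re (spectral_diag A 0 i).
  by move: dge0; rewrite lecE => /andP[].
rewrite -[X in _ <= X](rmorphXn (real_complex R)) /= exprMn sqr_sqrtr// rmorphM/=.
rewrite gram_spectral_diag_Re gram_spectral_diagE -/A -/P.
pose w : 'cV[R[i]]_N := col i (B *m P^t*).
have := Vb w; rewrite [X in _ <= _ * X](_ : _ = \sum_k `|(B *m P^t*) k i| ^+ 2); last first.
  by apply: eq_bigr => k _; rewrite /w [in LHS]mxE.
apply: le_trans.
pose u : 'rV[R[i]]_N := row i P.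
pose v : 'rV[R[i]]_N := (V *m w)^t*.
have uv : (P *m (V *m (B *m P^t*))) i i = (u *m v^t*) 0 0.
  rewrite /v trmxCK /u /w.
  have -> : V *m col i (B *m P^t*) = col i (V *m (B *m P^t*)).
    by rewrite !colE mulmxA.
  by rewrite !mxE; apply: eq_bigr => k _; rewrite [row _ _ _ _]mxE [col _ _ _ _]mxE.
rewrite uv -dotmxE.
have CS := @CauchySchwarz _ _ (@dotmx R[i] N) u v.
have uu : dotmx u u = 1.
  rewrite dotmxE /u; have /matrixP/(_ i i) := PP; rewrite [RHS]mxE eqxx /= => H.
  apply: etrans H.
  by rewrite !mxE; apply: eq_bigr => k _; rewrite !mxE.
have vv : dotmx v v = \sum_k `|(V *m w) k 0| ^+ 2.
  rewrite dotmxE /v trmxCK mxE; apply: eq_bigr => k _.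
  by rewrite !mxE normCK mulrC.
by case: CS; rewrite -[X in _ <= X * _]/(dotmx u u) -[X in _ <= _ * X]/(dotmx v v) uu vv mul1r.
Qed.

(** With [B = u *m w] one has [B^t* *m B = al *: (w^t* *m w)] and [w *m w^t* = be], so the rank one
    criterion applies with [c = al * be]. The value is the same for every exponent, whence the
    uniformity in the two exponents. *)
Lemma schatten_mul_col_row N q (u : 'cV[R[i]]_N) (w : 'rV[R[i]]_N) (al be : R) :
  q != 0 -> 0 <= al -> 0 <= be ->
  \sum_i `|u i 0| ^+ 2 = al%:C -> \sum_i `|w 0 i| ^+ 2 = be%:C ->
  schatten q (u *m w) = Num.sqrt (al * be).
Proof.
move=> q0 al0 be0 uE wE.
have uu : u^t* *m u = (al%:C)%:M.
  rewrite [LHS]mx11_scalar mxE -uE; congr (_%:M); apply: eq_bigr => i _.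
  by rewrite !mxE normCK mulrC.
have ww : w *m w^t* = (be%:C)%:M.
  rewrite [LHS]mx11_scalar mxE -wE; congr (_%:M); apply: eq_bigr => i _.
  by rewrite !mxE normCK.
have AE : (u *m w)^t* *m (u *m w) = al%:C *: (w^t* *m w).
  rewrite trmx_mul map_mxM /= -mulmxA [_ *m (u *m w)]mulmxA uu.
  by rewrite mul_scalar_mx -scalemxAr.
apply: schatten_rank1; rewrite ?mulr_ge0// AE.
- rewrite -scalemxAl -scalemxAr -mulmxA [w *m (_ *m _)]mulmxA ww.
  by rewrite mul_scalar_mx -scalemxAr !scalerA !rmorphM/=; congr (_ *: _); ring.
- by rewrite linearZ/= mxtrace_mulC ww mxtrace_scalar mulr1n rmorphM.
Qed.

End SchattenTheory.

(** * Hilbert's inequality *)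

Section HilbertMatrix.
Context {R : realType}.

(** A Toeplitz version of Hilbert's matrix; the shift by one half keeps every denominator away from
    0. *)
Definition hilb (j k : nat) : R := (j%:R - k%:R + 2^-1)^-1.

Definition half_harmonic (N : nat) : R := \sum_(n < N) (n%:R + 2^-1)^-1.

Lemma hilb_addr n j k : hilb (j + n) (k + n) = hilb j k.
Proof. by rewrite /hilb !natrD; congr (_^-1); ring. Qed.

Lemma hilb_den_neq0 (j k : nat) : j%:R - k%:R + 2^-1 != 0 :> R.
Proof.
have [le_kj|lt_jk] := leqP k j.
  by rewrite -natrB// gt_eqF// ltr_wpDl.
have : (j.+1)%:R <= k%:R :> R by rewrite ler_nat.
by rewrite -natr1 => ?; rewrite lt_eqF//; lra.
Qed.

(** The term of index 0 is already 2. This bound later lets the main term absorb the approximation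
    error for every size, including 1. *)
Lemma half_harmonic_ge2 N : (0 < N)%N -> 2 <= half_harmonic N.
Proof.
case: N => // N _; rewrite /half_harmonic big_ord_recl/= add0r invrK lerDl.
by rewrite sumr_ge0// => i _; rewrite invr_ge0 addr_ge0.
Qed.

(** The induction proves the bound for [ln N.+1%:R], which gives strictness; its step is ln(1 + x)
    <= x at x = 1/(N+1), which is at most 1/(N+1/2). *)
Lemma half_harmonic_gt_ln N : (0 < N)%N -> ln N%:R < half_harmonic N.
Proof.
move=> N0; apply: (@lt_le_trans _ _ (ln N.+1%:R)).
  by rewrite ltr_ln ?posrE ?ltr0n// ltr_nat.
elim: N {N0} => [|N IH]; first by rewrite ln1 /half_harmonic big_ord0.
rewrite /half_harmonic big_ord_recr/=.
have -> : N.+2%:R = N.+1%:R * (1 + N.+1%:R^-1) :> R.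
  by rewrite mulrDr mulfV ?pnatr_eq0// mulr1 natr1.
rewrite lnM ?posrE ?ltr0n ?addr_gt0//; apply: lerD; first exact: IH.
apply: (le_trans (le_ln1Dx _)); first by rewrite (@lt_le_trans _ _ 0).
rewrite lef_pV2 ?posrE ?ltr0n ?ltr_wpDl//.
by rewrite -(natr1 N); lra.
Qed.

Lemma sum_hilb_row j : \sum_(k < j.+1) hilb j k = half_harmonic j.+1.
Proof.
rewrite (reindex_inj rev_ord_inj); apply: eq_bigr => k _ /=.
have kj : (k <= j)%N by rewrite -ltnS.
by rewrite subSS /hilb natrB//; congr (_^-1); ring.
Qed.

(** In the induction step the two sides differ by half of [half_harmonic N.+1 - N / (N + 1/2)],
    which is positive because the first term is at least 2 and the second at most 1. *)
Lemma sum_half_harmonic_ge N :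
  N%:R * half_harmonic N / 2 <= \sum_(j < N) half_harmonic j.+1.
Proof.
elim: N => [|N IH]; first by rewrite big_ord0 !mul0r.
rewrite big_ord_recr/=; apply: le_trans (lerD IH (lexx _)).
have S2 := half_harmonic_ge2 (ltn0Sn N).
have SE : half_harmonic N = half_harmonic N.+1 - (N%:R + 2^-1)^-1.
  by rewrite [in RHS]/half_harmonic big_ord_recr/= addrK.
rewrite SE -(natr1 N); set S := half_harmonic _ in S2 *.
have : N%:R * (N%:R + 2^-1)^-1 <= 1 :> R.
  by rewrite ler_pdivrMr ?ltr_wpDl// mul1r lerDl.
set v := _^-1 => Hv; nra.
Qed.

(** The first term is 4. The others are dominated by 1/(t(t+1)) = 1/t - 1/(t+1), which telescopes to
    at most 1; the induction carries the tail 1/(k+1) along. *)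
Lemma sum_inv_sqr_le m : \sum_(n < m) (n%:R + 2^-1) ^- 2 <= 5 :> R.
Proof.
suff H k : \sum_(n < k.+1) (n%:R + 2^-1) ^- 2 <= 5 - k.+1%:R^-1 :> R.
  case: m => [|m]; first by rewrite big_ord0.
  by apply: le_trans (H m) _; rewrite gerBl.
elim: k => [|k IH]; first by rewrite big_ord1/= add0r exprVn invrK invr1; lra.
rewrite big_ord_recr/=; apply: le_trans (lerD IH (lexx _)) _.
rewrite -(natr1 k.+1); set t : R := k.+1%:R; have t0 : 0 < t by rewrite ltr0n.
suff : (t + 2^-1) ^- 2 <= t^-1 - (t + 1)^-1.
  by set u := _ ^- 2; set v := t^-1; set w := (_ + 1)^-1 => H; lra.
have -> : t^-1 - (t + 1)^-1 = (t * (t + 1))^-1.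
  by field; rewrite !gt_eqF// addr_gt0.
by rewrite lef_pV2 ?posrE ?exprn_gt0 ?mulr_gt0 ?addr_gt0//; nra.
Qed.

(** On each side of the cut between [j] and [j.+1] the denominators are, up to sign, the successive
    n + 1/2, so each side contributes at most 5. *)
Lemma sum_hilb_sqr_le M j : (j < M)%N -> \sum_(k < M) hilb j k ^+ 2 <= 10.
Proof.
move=> jM; rewrite -(big_mkord xpredT (fun k => hilb j k ^+ 2)).
rewrite (@big_cat_nat _ _ _ j.+1)//=.
have -> : 10 = 5 + 5 :> R by ring.
rewrite lerD//.
  rewrite big_mkord (reindex_inj rev_ord_inj).
  apply: le_trans (sum_inv_sqr_le j.+1); apply: ler_sum => k _ /=.
  have kj : (k <= j)%N by rewrite -ltnS.
  by rewrite subSS /hilb natrB// exprVn opprB addrCA subrr addr0.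
rewrite -{1}(add0n j.+1) big_addn big_mkord.
apply: le_trans (sum_inv_sqr_le (M - j.+1)); apply: ler_sum => k _ /=.
rewrite /hilb exprVn natrD -(natr1 j) le_eqVlt; apply/orP; left; apply/eqP.
by congr (_^-1); field.
Qed.

Lemma hilb_step M j : \sum_(k < M) hilb j.+1 k - \sum_(k < M) hilb j k =
  hilb j.+1 0 - hilb j.+1 M.
Proof.
rewrite -sumrB; elim: M => [|M IH]; first by rewrite big_ord0 subrr.
rewrite big_ord_recr/= IH; have -> : hilb j M = hilb j.+1 M.+1.
  by rewrite -[in RHS]addn1 -[M.+1]addn1 hilb_addr.
by ring.
Qed.

(** Moving the row by one changes the sum only by two boundary terms. A row index in the middle
    third of the window is at distance about N from both ends, so each of these terms is at most
    1/N. *)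
Lemma hilb_sum_lip N j d : (0 < N)%N -> (N <= j)%N -> (j + d < 2 * N)%N ->
  `|\sum_(k < 3 * N) hilb (j + d) k - \sum_(k < 3 * N) hilb j k|
  <= d%:R * (2 / N%:R).
Proof.
move=> N0 Nj; have N0' : 0 < N%:R :> R by rewrite ltr0n.
elim: d => [|d IH] jd; first by rewrite addn0 subrr normr0 mul0r.
rewrite -natr1 mulrDl mul1r addnS.
have -> : \sum_(k < 3 * N) hilb (j + d).+1 k - \sum_(k < 3 * N) hilb j k =
  (\sum_(k < 3 * N) hilb (j + d) k - \sum_(k < 3 * N) hilb j k) +
  (\sum_(k < 3 * N) hilb (j + d).+1 k - \sum_(k < 3 * N) hilb (j + d) k).
  by ring.
apply: le_trans (ler_normD _ _) _; rewrite lerD ?IH//; first by lia.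
rewrite hilb_step.
have h1 : `|hilb (j + d).+1 0| <= N%:R^-1.
  rewrite /hilb subr0 ger0_norm ?invr_ge0 ?addr_ge0//.
  rewrite lef_pV2 ?posrE ?addr_gt0 ?ltr0n//.
  have : N%:R <= (j + d).+1%:R :> R by rewrite ler_nat; lia.
  by lra.
have h2 : `|hilb (j + d).+1 (3 * N)| <= N%:R^-1.
  have : (j + d).+2%:R <= 2 * N%:R :> R by rewrite -natrM ler_nat; lia.
  rewrite /hilb normrV ?unitfE ?hilb_den_neq0//.
  rewrite lef_pV2 ?posrE ?normr_gt0 ?hilb_den_neq0//.
  rewrite -(natr1 (j + d).+1) natrM => H; rewrite ler0_norm; lra.
apply: le_trans (ler_normB _ _) _.
by rewrite mulr2n mulrDl mul1r lerD.
Qed.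

(* Since h(j,k) h(l,k) = (h(j,k) - h(l,k)) / (l - j), the sum over k telescopes;
   letting k range over a window three times as long makes the boundary terms
   O(1/N), so that the Gram matrix is nearly diagonal. *)
Lemma hilb_gram_le N j l : (N <= j < 2 * N)%N -> (N <= l < 2 * N)%N ->
  `|\sum_(k < 3 * N) hilb j k * hilb l k| <= 10 *+ (j == l) + 2 / N%:R.
Proof.
wlog le_jl : j l / (j <= l)%N.
  move=> H jN lN; have [/H|/ltnW/H] := leqP j l; first exact.
  move=> /(_ lN jN); rewrite eq_sym.
  by under eq_bigr do rewrite mulrC.
move=> /andP[Nj j2N] /andP[Nl l2N].
have N0 : (0 < N)%N by lia.
have [<-|ne_jl] := eqVneq j l.
  rewrite ger0_norm ?sumr_ge0// => [|k _]; last by rewrite -expr2 sqr_ge0.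
  under eq_bigr do rewrite -expr2.
  rewrite mulr1n; apply: le_trans (@sum_hilb_sqr_le (3 * N) j _) _.
    by lia.
  by rewrite lerDl divr_ge0.
rewrite mulr0n add0r.
have lt_jl : (j < l)%N by rewrite ltn_neqAle ne_jl.
have lj0 : 0 < l%:R - j%:R :> R by rewrite subr_gt0 ltr_nat.
have -> : \sum_(k < 3 * N) hilb j k * hilb l k =
   - (\sum_(k < 3 * N) hilb l k - \sum_(k < 3 * N) hilb j k) / (l%:R - j%:R).
  rewrite -sumrB -sumrN mulr_suml; apply: eq_bigr => k _.
  have p0 := hilb_den_neq0 j k; have q0 := hilb_den_neq0 l k.
  rewrite /hilb; move: p0 q0 lj0; set p := j%:R - _ + _; set q := l%:R - _ + _.
  have -> : l%:R - j%:R = q - p by rewrite /p /q; ring.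
  by move=> p0 q0 qp; field; rewrite p0 q0 gt_eqF.
rewrite normrM normrN normrV ?unitfE ?gt_eqF// (gtr0_norm lj0).
rewrite ler_pdivrMr//.
have := @hilb_sum_lip N j (l - j) N0 Nj.
rewrite subnKC// => /(_ l2N); rewrite natrB//.
by rewrite mulrC.
Qed.

(** By translation invariance the rows may be moved to the middle third of a window of length 3N,
    and adding columns only increases the left side. The Gram bound, with 2|x_j x_l| <= x_j^2 +
    x_l^2 for the part of size 2/N, then gives the constant 10 + 2 = 12; it is rounded up to 16 =
    4^2. *)
Lemma hilbert_inequality N (x : 'I_N -> R) :
  \sum_(k < N) (\sum_(j < N) hilb j k * x j) ^+ 2 <= 16 * \sum_j x j ^+ 2.
Proof.
move: x.
have [->|N0] := posnP N; first by move=> x; rewrite !big_ord0 mulr0.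
move=> x; have N0' : 0 < N%:R :> R by rewrite ltr0n.
pose y k := \sum_(j < N) hilb (j + N) k * x j.
apply: (@le_trans _ _ (\sum_(k < 3 * N) y k ^+ 2)).
  have -> : \sum_(k < N) (\sum_(j < N) hilb j k * x j) ^+ 2 =
            \sum_(N <= k < N + N) y k ^+ 2.
    rewrite -[X in index_iota X _](add0n N) big_addn addnK big_mkord; apply: eq_bigr => k _.
    by rewrite /y; under [in RHS]eq_bigr do rewrite hilb_addr.
  rewrite -(big_mkord xpredT (fun k => y k ^+ 2)).
  rewrite [leRHS](@big_cat_nat _ _ _ N)/= ?leq0n//; last by lia.
  rewrite [X in _ + X](@big_cat_nat _ _ _ (N + N)%N)/=; [|lia..].
  rewrite addrCA lerDl addr_ge0// sumr_ge0// => i _; exact: sqr_ge0.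
pose G j l := \sum_(k < 3 * N) hilb (j + N) k * hilb (l + N) k.
have -> : \sum_(k < 3 * N) y k ^+ 2 =
    \sum_(j < N) \sum_(l < N) G j l * (x j * x l).
  under [RHS]eq_bigr => j _ do under eq_bigr => l _ do rewrite mulr_suml.
  under [RHS]eq_bigr => j _ do rewrite exchange_big/=.
  rewrite [RHS]exchange_big/=; apply: eq_bigr => k _.
  rewrite expr2 /y big_distrlr/=; apply: eq_bigr => j _; apply: eq_bigr => l _.
  by ring.
pose X := \sum_(j < N) x j ^+ 2.
(* The diagonal part contributes 10 X, and the two squares averaged over N indices contribute X
   each. *)
have boundE : \sum_(j < N) \sum_(l < N)
    (10 * (x j ^+ 2) *+ (j == l) + N%:R^-1 * (x j ^+ 2 + x l ^+ 2)) = 12 * X.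
  under eq_bigr => j _.
    rewrite big_split/= -mulr_sumr big_split/= sumr_const card_ord.
    rewrite (bigD1 j)//= eqxx big1 ?addr0; last first.
      by move=> l; rewrite eq_sym => /negbTE ->.
    rewrite mulr1n -/X; over.
  rewrite big_split/= -!mulr_sumr big_split/= -/X sumr_const card_ord.
  rewrite ?sumrMnl -?[\sum_(i < N) x i ^+ 2]/X.
  have -> : X *+ N = N%:R * X by rewrite mulr_natl.
  field.
  by rewrite gt_eqF.
apply: (@le_trans _ _ (12 * X)); last first.
  by apply: ler_wpM2r; [rewrite sumr_ge0// => i _; exact: sqr_ge0|lra].
rewrite -boundE; apply: ler_sum => j _; apply: ler_sum => l _.
apply: le_trans (ler_norm _) _; rewrite normrM.
have H := @hilb_gram_le N (j + N) (l + N).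
have {}H : `|G j l| <= 10 *+ (j == l) + 2 / N%:R.
  have := ltn_ord j; have := ltn_ord l.
  by rewrite -val_eqE /= -(eqn_add2r N) => *; apply: H; lia.
have [jl|jl] := eqVneq j l.
  rewrite -jl in H *; rewrite eqxx !mulr1n in H *.
  have -> : `|x j * x j| = x j ^+ 2 by rewrite ger0_norm -expr2// sqr_ge0.
  apply: le_trans (ler_wpM2r (sqr_ge0 _) H) _.
  by rewrite mulrDl lerD2l le_eqVlt; apply/orP; left; apply/eqP; ring.
rewrite (negbTE jl) !mulr0n !add0r in H *.
apply: le_trans (ler_wpM2r (normr_ge0 _) H) _.
rewrite -mulrA [2 * _]mulrC -mulrA ler_pM2l ?invr_gt0//.
rewrite normrM -(real_normK (num_real (x j))) -(real_normK (num_real (x l))).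
have := sqr_ge0 (`|x j| - `|x l|); nra.
Qed.

Lemma norm_hilb_le2 (j k : nat) : `|hilb j k| <= 2 :> R.
Proof.
rewrite /hilb normfV -[leRHS]invrK lef_pV2 ?posrE ?normr_gt0 ?hilb_den_neq0 ?invr_gt0//.
have [le_kj|lt_jk] := leqP k j.
  have : k%:R <= j%:R :> R by rewrite ler_nat.
  by move=> ?; rewrite ger0_norm; lra.
have : (j.+1)%:R <= k%:R :> R by rewrite ler_nat.
by rewrite -(natr1 j) => ?; rewrite ler0_norm; lra.
Qed.

(** The source of the logarithm: each row of the lower triangle sums to a half-harmonic number, with
    no cancellation, although the full matrix is bounded. *)
Lemma sum_lower_hilb_ge N :
  N%:R * half_harmonic N / 2 <=
  \sum_(j < N) \sum_(k < N) (k <= j)%N%:R * hilb j k :> R.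
Proof.
apply: le_trans (sum_half_harmonic_ge N) _; apply: ler_sum => j _.
rewrite -sum_hilb_row (big_ord_widen N (hilb j))// big_mkcond/=.
by apply: ler_sum => k _; rewrite ltnS; case: leqP; rewrite ?mul1r ?mul0r.
Qed.

(** Diagonal unitaries on either side preserve the Euclidean norm, and the real matrix acts
    separately on real and imaginary parts. *)
Lemma hilbert_inequality_twisted N (e f : nat -> R[i]) (x : 'cV[R[i]]_N) :
  (forall k, `|e k| = 1) -> (forall j, `|f j| = 1) ->
  \sum_k `|((\matrix_(k < N, j < N) ((hilb j k)%:C * (e k * f j))) *m x) k 0| ^+ 2
    <= (4 ^+ 2)%:C * \sum_j `|x j 0| ^+ 2.
Proof.
move=> e1 f1; pose y (j : 'I_N) := f j * x j 0.
pose u k := \sum_(j < N) hilb j k * Re (y j).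
pose v k := \sum_(j < N) hilb j k * Im (y j).
have -> : \sum_j `|x j 0| ^+ 2 =
    (\sum_j Re (y j) ^+ 2 + \sum_j Im (y j) ^+ 2)%:C.
  rewrite -big_split/= rmorph_sum; apply: eq_bigr => j _.
  rewrite -[RHS]/((Re (y j) ^+ 2 + Im (y j) ^+ 2)%:C) add_Re2_Im2.
  by rewrite /y normrM f1 mul1r.
have -> : \sum_k `|((\matrix_(k < N, j < N)
    ((hilb j k)%:C * (e k * f j))) *m x) k 0| ^+ 2 =
    (\sum_(k < N) u k ^+ 2 + \sum_(k < N) v k ^+ 2)%:C.
  rewrite -big_split/= rmorph_sum; apply: eq_bigr => k _.
  have -> : ((\matrix_(k < N, j < N)
      ((hilb j k)%:C * (e k * f j))) *m x) k 0 = e k * (u k +i* v k).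
    rewrite mxE; under eq_bigr do rewrite mxE.
    have -> : u k +i* v k = \sum_(j < N) (hilb j k)%:C * y j.
      apply/eqP; rewrite eq_complex; apply/andP; split; apply/eqP.
        rewrite (raddf_sum (@complex.Re R)); apply: eq_bigr => j _.
        by case: (y j) => a b /=; rewrite mul0r subr0.
      rewrite (raddf_sum (@complex.Im R)); apply: eq_bigr => j _.
      by case: (y j) => a b /=; rewrite mul0r addr0.
    by rewrite mulr_sumr; apply: eq_bigr => j _; rewrite /y; ring.
  by rewrite normrM e1 mul1r -add_Re2_Im2.
rewrite -rmorphM lecR mulrDr (_ : 4 ^+ 2 = 16 :> R); last by ring.
by apply: lerD; apply: hilbert_inequality.
Qed.

End HilbertMatrix.

(** * The triangle function and its transform *)

Section Triangle.
Context {R : realType}.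
Notation mu := (@lebesgue_measure R).

Definition tri (x : R) : R := Num.max 0 (1 - `|x|).

Lemma tri_ge0 x : 0 <= tri x.
Proof. by rewrite le_max lexx. Qed.

Lemma tri_eq0 x : 1 <= `|x| -> tri x = 0.
Proof. by move=> x1; apply/max_idPl; rewrite subr_le0. Qed.

Lemma continuous_tri : continuous tri.
Proof.
move=> x; apply: (@continuous_max _ _ (cst 0) (fun x => 1 - `|x|)).
  exact: cvg_cst.
by apply: cvgB; [exact: cvg_cst|exact: norm_continuous].
Qed.

Lemma continuous_triB a : continuous (fun x => tri (x - a)).
Proof.
move=> x; apply: (@continuous_comp _ _ _ (fun x => x - a) tri).
  by apply: cvgB; [exact: cvg_id|exact: cvg_cst].
exact: continuous_tri.
Qed.

Lemma continuous_triM a (h : R -> R) : continuous h ->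
  continuous (fun x => tri (x - a) * h x).
Proof. by move=> ch x; apply: cvgM; [exact: continuous_triB|exact: ch]. Qed.

Lemma triM_restrict a (h : R -> R) :
  (fun x => tri (x - a) * h x) = (fun x => tri (x - a) * h x) \_ `[a - 1, a + 1].
Proof.
apply/funext => x; rewrite patchE; case: ifPn => //.
rewrite notin_setE/= in_itv/= => /negP; rewrite negb_and -!ltNge => xa.
rewrite tri_eq0 ?mul0r//; case/orP: xa => xa.
  by rewrite ler0_norm; lra.
by rewrite ger0_norm; lra.
Qed.

Lemma integrable_triM a (h : R -> R) : continuous h ->
  mu.-integrable setT (EFin \o (fun x => tri (x - a) * h x)).
Proof.
move=> ch; rewrite triM_restrict -restrict_EFin.
set f := fun x => tri (x - a) * h x.
have mI : measurable `[a - 1, a + 1] by exact: measurable_itv.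
apply: (integrable_mkcond (mu:=mu) (EFin \o f) mI).1.
apply: continuous_compact_integrable; first exact: segment_compact.
exact/continuous_subspaceT/continuous_triM.
Qed.

Lemma Rintegral_FTC2 (f F : R -> R) (a b : R) : a < b -> continuous f ->
  (forall x : R, is_derive x 1 F (f x)) ->
  \int[mu]_(x in `[a, b]) f x = F b - F a.
Proof.
move=> ab cf dF.
have cF x : {for x, continuous F}.
  by apply/differentiable_continuous/derivable1_diffP/ex_derive.
rewrite /Rintegral (@continuous_FTC2 _ _ F)//.
- exact: continuous_subspaceT.
- split; first by move=> x _; apply: ex_derive.
  + exact/cvg_at_right_filter/cF.
  + exact/cvg_at_left_filter/cF.
- by move=> x _; rewrite derive1E; apply: derive_val.
Qed.

(* Integrating by parts twice turns the integral against a triangle into a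
   second difference. *)
Lemma Rintegral_triM (a : R) (h H1 H2 : R -> R) : continuous h ->
  (forall x : R, is_derive x 1 H1 (h x)) -> (forall x : R, is_derive x 1 H2 (H1 x)) ->
  \int[mu]_x (tri (x - a) * h x) = H2 (a + 1) + H2 (a - 1) - 2 * H2 a.
Proof.
move=> ch dH1 dH2; set f := fun x => tri (x - a) * h x.
have cf : continuous f by exact: continuous_triM.
rewrite -/f [f]triM_restrict -/f -Rintegral_mkcond.
have fi (c d : R) : mu.-integrable `[c, d] (EFin \o f).
  apply: continuous_compact_integrable; first exact: segment_compact.
  exact: continuous_subspaceT.
have a1 : (BLeft (a - 1) <= BRight a)%O by rewrite bnd_simp; lra.
have a2 : (BRight a <= BRight (a + 1))%O by rewrite bnd_simp; lra.
have E := Rintegral_itvB (fi (a - 1) (a + 1)) a1 a2.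
rewrite -[LHS](subrK (\int[mu]_(x in `[a - 1, a]) f x)) E.
rewrite Rintegral_itv_obnd_cbnd; last first.
  by apply: integrableS (fi a (a + 1)) => //; apply: subset_itv; rewrite bnd_simp.
have e1 : \int[mu]_(x in `[a - 1, a]) f x = H1 a - H2 a + H2 (a - 1).
  have -> : \int[mu]_(x in `[a - 1, a]) f x =
            \int[mu]_(x in `[a - 1, a]) ((x - a + 1) * h x).
    apply: eq_Rintegral => x; rewrite inE/= in_itv/= /f /tri => /andP[x1 x2].
    by rewrite ler0_norm ?subr_le0// max_r; [congr (_ * _); ring|lra].
  have cL : continuous (fun x => (x - a + 1) * h x).
    by move=> x; apply: cvgM; [|exact: ch];
      apply: cvgD; [apply: cvgB; [exact: cvg_id|]|]; exact: cvg_cst.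
  have dL (x : R) :
      is_derive x 1 (fun x => (x - a + 1) * H1 x - H2 x) ((x - a + 1) * h x).
    apply: is_derive_eq; by rewrite /GRing.scale/=; ring.
  by rewrite (Rintegral_FTC2 _ cL dL); [ring|lra].
have e2 : \int[mu]_(x in `[a, a + 1]) f x = - H1 a - H2 a + H2 (a + 1).
  have -> : \int[mu]_(x in `[a, a + 1]) f x =
            \int[mu]_(x in `[a, a + 1]) ((1 - (x - a)) * h x).
    apply: eq_Rintegral => x; rewrite inE/= in_itv/= /f /tri => /andP[x1 x2].
    by rewrite ger0_norm ?subr_ge0// max_r; lra.
  have cL : continuous (fun x => (1 - (x - a)) * h x).
    by move=> x; apply: cvgM; [|exact: ch];
      apply: cvgB; [|apply: cvgB; [exact: cvg_id|]]; exact: cvg_cst.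
  have dL (x : R) :
      is_derive x 1 (fun x => (1 - (x - a)) * H1 x + H2 x) ((1 - (x - a)) * h x).
    apply: is_derive_eq; by rewrite /GRing.scale/=; ring.
  by rewrite (Rintegral_FTC2 _ cL dL); [ring|lra].
by rewrite e1 e2; ring.
Qed.

(** The transform of [tri], that is the square of sin(s/2)/(s/2). As division by 0 gives 0, the
    value at 0 is 0 and not the limit 1, so transform identities are stated away from 0. *)
Definition fejer (s : R) : R := 2 * (1 - cos s) / s ^+ 2.

Lemma is_derive_sin_scale (s x : R) :
  is_derive x 1 (fun x => sin (s * x)) (s * cos (s * x)).
Proof.
have dg : is_derive x 1 (fun x : R => s * x) s.
  by apply: is_derive_eq; rewrite /GRing.scale/=; ring.
have := @is_derive1_comp _ sin (fun x => s * x) x (cos (s * x)) s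
  (is_derive_sin _) dg.
by rewrite mulrC.
Qed.

Lemma is_derive_cos_scale (s x : R) :
  is_derive x 1 (fun x => cos (s * x)) (- (s * sin (s * x))).
Proof.
have dg : is_derive x 1 (fun x : R => s * x) s.
  by apply: is_derive_eq; rewrite /GRing.scale/=; ring.
have := @is_derive1_comp _ cos (fun x => s * x) x (- sin (s * x)) s
  (is_derive_cos _) dg.
by rewrite mulrC mulrN.
Qed.

Lemma continuous_cos_scale (s : R) : continuous (fun x => cos (s * x)).
Proof.
move=> x; apply: (@continuous_comp _ _ _ (fun x => s * x) cos).
  exact: mulrl_continuous.
exact: continuous_cos.
Qed.

Lemma continuous_sin_scale (s : R) : continuous (fun x => sin (s * x)).
Proof.
move=> x; apply: (@continuous_comp _ _ _ (fun x => s * x) sin).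
  exact: mulrl_continuous.
exact: continuous_sin.
Qed.

Lemma Rintegral_tri_cos a s : s != 0 ->
  \int[mu]_x (tri (x - a) * cos (s * x)) = fejer s * cos (s * a).
Proof.
move=> s0.
have d1 (x : R) : is_derive x 1 (fun x => s^-1 * sin (s * x)) (cos (s * x)).
  have := is_derive_sin_scale s x => ?.
  by apply: is_derive_eq; rewrite /GRing.scale/=; field.
have d2 (x : R) : is_derive x 1 (fun x => - s ^- 2 * cos (s * x))
    (s^-1 * sin (s * x)).
  have := is_derive_cos_scale s x => ?.
  by apply: is_derive_eq; rewrite /GRing.scale/=; field.
rewrite (Rintegral_triM a (@continuous_cos_scale s) d1 d2).
by rewrite /fejer mulrDr mulrBr mulr1 cosD cosB; field.
Qed.

Lemma Rintegral_tri_sin a s : s != 0 ->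
  \int[mu]_x (tri (x - a) * sin (s * x)) = fejer s * sin (s * a).
Proof.
move=> s0.
have d1 (x : R) : is_derive x 1 (fun x => - s^-1 * cos (s * x)) (sin (s * x)).
  have := is_derive_cos_scale s x => ?.
  by apply: is_derive_eq; rewrite /GRing.scale/=; field.
have d2 (x : R) : is_derive x 1 (fun x => - s ^- 2 * sin (s * x))
    (- s^-1 * cos (s * x)).
  have := is_derive_sin_scale s x => ?.
  by apply: is_derive_eq; rewrite /GRing.scale/=; field.
rewrite (Rintegral_triM a (@continuous_sin_scale s) d1 d2).
by rewrite /fejer mulrDr mulrBr mulr1 sinD sinB; field.
Qed.

Lemma Rintegral_tri a : \int[mu]_x tri (x - a) = 1.
Proof.
have c1 : continuous (fun _ : R => 1 : R) by move=> x; exact: cvg_cst.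
have d1 (x : R) : is_derive x 1 (fun x : R => x) 1 by exact: is_derive_id.
have d2 (x : R) : is_derive x 1 (fun x : R => 2^-1 * (x * x)) x.
  by apply: is_derive_eq; rewrite /GRing.scale/=; field.
under eq_Rintegral do rewrite -[tri _]mulr1.
by rewrite (Rintegral_triM a c1 d1 d2); field.
Qed.

Lemma fejer_ge0 s : 0 <= fejer s.
Proof. by rewrite divr_ge0 ?sqr_ge0// mulr_ge0// subr_ge0 cos_le1. Qed.

Lemma fejer_sin2 s : fejer s = (2 * sin (s / 2) / s) ^+ 2.
Proof.
rewrite /fejer {1}(_ : s = (s / 2) *+ 2); last by rewrite -mulr_natr divfK.
rewrite cos_mulr2n cos2sin2 -mulr_natr.
have [->|s0] := eqVneq s 0; first by rewrite expr0n/= !invr0 !mulr0 expr0n.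
by field.
Qed.

Lemma sin_mean_value (x : R) : 0 < x ->
  exists2 c, 0 < c < x & sin x = cos c * x.
Proof.
move=> x0.
have [|c] := @MVT R sin cos 0 x x0 (fun x _ => is_derive_sin x).
  exact/continuous_subspaceT/continuous_sin.
by rewrite in_itv/= sin0 !subr0; exists c.
Qed.

Lemma norm_sin_le (x : R) : `|sin x| <= `|x|.
Proof.
wlog x0 : x / 0 < x => [H|].
  have [/H//|x0|<-] := ltgtP 0 x; last by rewrite sin0.
  by rewrite -normrN -sinN -[leRHS]normrN H// oppr_gt0.
have [c _ ->] := sin_mean_value x0.
by rewrite normrM ler_piMl// cos_max.
Qed.

Lemma sin_ge_cos1 (x : R) : 0 < x <= 1 -> cos 1 * x <= sin x.
Proof.
move=> /andP[x0 x1]; have [c /andP[c0 cx] ->] := sin_mean_value x0.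
have pi2 := @pi_ge2 R.
rewrite ler_pM2r// ltW// ltr_cos ?in_itv/=; lra.
Qed.

Lemma fejer_le1 s : fejer s <= 1.
Proof.
rewrite fejer_sin2 -real_normK ?num_real// expr_le1//.
rewrite normrM normfV; have [->|s0] := eqVneq s 0; first by rewrite normr0 invr0 mulr0.
rewrite ler_pdivrMr ?normr_gt0// mul1r normrM.
have := norm_sin_le (s / 2); rewrite normrM normfV (ger0_norm (_ : 0 <= 2))//; lra.
Qed.

(** Supplies a lower bound on an interval of length 1, over which the trace norm will be
    integrated. *)
Lemma fejer_ge_cos1 s : 0 < s <= 1 -> cos 1 ^+ 2 <= fejer s.
Proof.
move=> /andP[s0 s1]; rewrite fejer_sin2.
have H : cos 1 <= 2 * sin (s / 2) / s.
  rewrite ler_pdivlMr//.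
  have := @sin_ge_cos1 (s / 2); rewrite mulrA => H.
  suff : cos 1 * s / 2 <= sin (s / 2) by lra.
  by apply: H; apply/andP; split; lra.
have c0 : 0 <= cos 1 :> R by have := @cos1_gt0 R; lra.
by rewrite lerXn2r ?nnegrE//; exact: le_trans H.
Qed.

(** Adding [fejer s <= 1] and [s ^+ 2 * fejer s <= 4] gives the constant 5; the majorant has
    integral 5 pi. *)
Lemma fejer_le_oneDsqr s : fejer s <= 5 * (oneDsqr s)^-1.
Proof.
rewrite ler_pdivlMr; last by rewrite ltr_pwDl// sqr_ge0.
rewrite /oneDsqr mulrDr mulr1 -[leRHS](_ : 1 + 4 = _); last by ring.
rewrite lerD ?fejer_le1//; have [->|s0] := eqVneq s 0.
  by rewrite expr0n/= mulr0.
rewrite /fejer divfK ?expf_neq0//.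
by have := cos_geN1 s; lra.
Qed.

Lemma integral_oneDsqr : (\int[mu]_x ((oneDsqr x)^-1)%:E = pi%:E)%E.
Proof.
rewrite ge0_symfun_integralT.
- rewrite (_ : [set x : R | (0 <= x)%R] = `[0%R, +oo[%classic).
    by rewrite integral0y_oneDsqr -EFinM; congr _%:E; field.
  by apply/seteqP; split=> x /=; rewrite in_itv/= andbT.
- by move=> x; rewrite invr_ge0 addr_ge0// sqr_ge0.
- exact: continuous_oneDsqrV.
- by move=> x; rewrite /= /oneDsqr sqrrN.
Qed.

Lemma measurable_invr : measurable_fun setT (GRing.inv : R -> R).
Proof.
rewrite -(setUv [set 0]); apply/measurable_funU => //; first exact: measurableC.
split; first exact: measurable_fun_set1.
apply: open_continuous_measurable_fun.
  apply/closed_openC/accessible_closed_set1/hausdorff_accessible; exact: Rhausdorff.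
move=> x; rewrite inE/= => /eqP x0; exact: inv_continuous.
Qed.

Lemma measurable_fejer : measurable_fun setT fejer.
Proof.
apply: measurable_funM.
  apply: measurable_funM; first exact: measurable_cst.
  apply: measurable_funB; first exact: measurable_cst.
  by apply: continuous_measurable_fun; exact: continuous_cos.
apply: (measurableT_comp measurable_invr).
exact: measurable_funX.
Qed.

End Triangle.

(** * Integrals against triangles *)

Section TensorTriangle.
Context {R : realType}.
Notation mu := (@lebesgue_measure R).
Implicit Types (a b s : R) (h : R -> R -> R).

(** The multiple [c] of the indicator of [A] is one of the simple functions below [f] whose supremum
    defines the integral. The bound thus applies directly to the trace norm of the multiplier. *)
Lemma integral_ge_cst d (T : measurableType d) (nu : {measure set T -> \bar R})
    (A : set T) (f : T -> \bar R) (c : R) : measurable A -> 0 <= c ->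
  (forall x, 0 <= f x)%E -> (forall x, A x -> (c%:E <= f x)%E) ->
  (c%:E * nu A <= \int[nu]_x f x)%E.
Proof.
move=> mA c0 f0 fc; rewrite ge0_integralTE//; apply: ereal_sup_ubound.
exists (scale_nnsfun (indic_nnsfun R mA) c0).
  move=> x; rewrite -[X in (X <= _)%E]/((c * \1_A x)%:E) indicE.
  case: (boolP (x \in A)) => [|_]; last by rewrite mulr0.
  by rewrite inE mulr1; exact: fc.
rewrite -integralT_nnsfun; transitivity (\int[nu]_x (c%:E * (\1_A x)%:E))%E.
  by apply: eq_integral => x _.
rewrite ge0_integralZl_EFin//; last by apply/measurable_EFinP/measurable_indic.
by rewrite integral_indic// setIT.
Qed.

(** The coefficients (1, 0) and (0, 1) give the real and imaginary parts of the exponential, and the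
    family is stable under the addition formulas, so the lemma can be iterated over two
    variables. *)
Lemma Rintegral_tri_trig a s A B : s != 0 ->
  \int[mu]_x (tri (x - a) * (A * cos (s * x) + B * sin (s * x))) =
  fejer s * (A * cos (s * a) + B * sin (s * a)).
Proof.
move=> s0.
rewrite (_ : (fun _ => _) = (fun x => A * (tri (x - a) * cos (s * x)) +
    B * (tri (x - a) * sin (s * x)))); last by apply/funext => x; ring.
have ic := @integrable_triM R a _ (@continuous_cos_scale R s).
have iS := @integrable_triM R a _ (@continuous_sin_scale R s).
rewrite RintegralD//.
- rewrite RintegralZl//; rewrite RintegralZl//.
  by rewrite Rintegral_tri_cos// Rintegral_tri_sin//; ring.
- by have := integrableZl measurableT A ic.
- by have := integrableZl measurableT B iS.
Qed.

(** A sufficient condition for Fubini's theorem. The outer variable is centred at [b] and the inner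
    one at [a], as in the order of integration of [bilinear_mult]. *)
Definition tri_dominated a b (h : R -> R -> R) : Prop :=
  measurable_fun setT (fun z : R * R => h z.1 z.2) /\
  exists K : R, forall x y, `|h x y| <= K * (tri (x - b) * tri (y - a)).

Lemma measurable_tri : measurable_fun setT (@tri R).
Proof. by apply: continuous_measurable_fun; exact: continuous_tri. Qed.

Lemma measurable_tensor_tri a b :
  measurable_fun setT (fun z : R * R => tri (z.1 - b) * tri (z.2 - a)).
Proof.
apply: measurable_funM; apply: (measurableT_comp measurable_tri);
  apply: measurable_funB => //; exact: measurable_cst.
Qed.

Lemma integrable_tri a : mu.-integrable setT (EFin \o (fun x => tri (x - a))).
Proof.
have c1 : continuous (fun _ : R => 1 : R) by move=> x; exact: cvg_cst.
have := integrable_triM a c1.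
by under eq_fun do rewrite mulr1.
Qed.

Lemma integral_tri a : (\int[mu]_x (tri (x - a))%:E = 1)%E.
Proof.
rewrite -[RHS]/((1 : R)%:E) -(Rintegral_tri a) /Rintegral fineK//.
exact: integrable_fin_num (integrable_tri a).
Qed.

Lemma integral_tensor_tri a b :
  (\int[mu]_x \int[mu]_y (tri (x - b) * tri (y - a))%:E = 1)%E.
Proof.
under eq_integral => x _.
  under eq_integral do rewrite EFinM.
  rewrite integralZl//; last exact: integrable_tri.
  rewrite integral_tri mule1; over.
exact: integral_tri.
Qed.

Lemma integrable_tensor_tri a b : (mu \x mu)%E.-integrable setT
  (EFin \o (fun z : R * R => tri (z.1 - b) * tri (z.2 - a))).
Proof.
apply/integrable12ltyP; first by apply/measurable_EFinP; exact: measurable_tensor_tri.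
under eq_integral => x _.
  under eq_integral => y _ do
    rewrite /= ger0_norm ?mulr_ge0 ?tri_ge0//.
  over.
by rewrite integral_tensor_tri ltry.
Qed.

Lemma tri_dominated_integrable a b h : tri_dominated a b h ->
  (mu \x mu)%E.-integrable setT (EFin \o (fun z : R * R => h z.1 z.2)).
Proof.
move=> [mh [K hK]].
have iK := integrableZl measurableT K (integrable_tensor_tri a b).
apply: (le_integrable measurableT _ _ iK); first exact/measurable_EFinP.
move=> [x y] _ /=; rewrite lee_fin.
by apply: le_trans (hK x y) _; exact: ler_norm.
Qed.

Lemma tri_dominated_section a b h x : tri_dominated a b h ->
  mu.-integrable setT (EFin \o (h x)).
Proof.
move=> [mh [K hK]].
have iK := integrableZl measurableT (K * tri (x - b)) (integrable_tri a).
apply: (le_integrable measurableT _ _ iK).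
  apply/measurable_EFinP.
  exact: (measurableT_comp mh (pair1_measurable x)).
move=> y _ /=; rewrite lee_fin.
by apply: le_trans (hK x y) _; rewrite mulrA; exact: ler_norm.
Qed.

Lemma Rintegral12 a b h : tri_dominated a b h ->
  \int[mu]_x \int[mu]_y h x y =
  \int[(mu \x mu)%E]_z h z.1 z.2.
Proof.
move=> hd; rewrite {1}/Rintegral [in RHS]/Rintegral.
rewrite -(integral12_prod_meas1 (tri_dominated_integrable hd)); congr fine.
apply: eq_integral => x _; rewrite /fubini_F/= fineK//.
exact: integrable_fin_num (tri_dominated_section x hd).
Qed.

(** The product of two unit triangles has total mass 1, so a pointwise error of [D] times this
    product integrates to at most [D]. *)
Lemma Rintegral12_dist a b h1 h2 D :
  tri_dominated a b h1 -> tri_dominated a b h2 ->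
  (forall x y, `|h1 x y - h2 x y| <= D * (tri (x - b) * tri (y - a))) ->
  `|\int[mu]_x \int[mu]_y h1 x y - \int[mu]_x \int[mu]_y h2 x y| <= D.
Proof.
move=> hd1 hd2 hD.
have i1 := tri_dominated_integrable hd1; have i2 := tri_dominated_integrable hd2.
have iG := integrable_tensor_tri a b.
have id : (mu \x mu)%E.-integrable setT
    (EFin \o (fun z : R * R => h1 z.1 z.2 - h2 z.1 z.2)).
  by have := integrableB measurableT i1 i2.
rewrite (Rintegral12 hd1) (Rintegral12 hd2) -RintegralB//.
apply: le_trans (le_normr_Rintegral measurableT id) _.
apply: (@le_trans _ _ (\int[(mu \x mu)%E]_z (D * (tri (z.1 - b) * tri (z.2 - a))))).
  apply: le_Rintegral => //.
  - by have := integrable_norm id.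
  - by have := integrableZl measurableT D iG.
rewrite RintegralZl// -(@Rintegral12 a b (fun x y => tri (x - b) * tri (y - a))).
  rewrite (_ : \int[mu]_x _ = 1) ?mulr1//.
  under eq_Rintegral => x _.
    rewrite RintegralZl//; last exact: integrable_tri.
    rewrite Rintegral_tri mulr1; over.
  exact: Rintegral_tri.
split; first exact: measurable_tensor_tri.
by exists 1 => x y; rewrite mul1r ger0_norm// mulr_ge0 ?tri_ge0.
Qed.

(** The model case of a constant symbol: each of the two integrations produces one factor
    [fejer s]. *)
Lemma Rintegral12_tri_trig a b s c A B : s != 0 ->
  \int[mu]_x \int[mu]_y
    (c * (tri (x - b) * tri (y - a)) *
     (A * cos (s * (y + x)) + B * sin (s * (y + x)))) =
  c * fejer s ^+ 2 * (A * cos (s * (a + b)) + B * sin (s * (a + b))).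
Proof.
move=> s0.
under eq_Rintegral => x _.
  rewrite (_ : (fun _ => _) = (fun y => tri (y - a) *
     ((c * tri (x - b) * (A * cos (s * x) + B * sin (s * x))) * cos (s * y) +
      (c * tri (x - b) * (B * cos (s * x) - A * sin (s * x))) * sin (s * y))));
    last by apply/funext => y; rewrite [s * _]mulrDr cosD sinD; ring.
  rewrite Rintegral_tri_trig//; over.
rewrite (_ : (fun _ => _) = (fun x => tri (x - b) *
     ((c * fejer s * (A * cos (s * a) + B * sin (s * a))) * cos (s * x) +
      (c * fejer s * (B * cos (s * a) - A * sin (s * a))) * sin (s * x))));
    last by apply/funext => y; ring.
by rewrite Rintegral_tri_trig// [s * (a + b)]mulrDr cosD sinD; ring.
Qed.

End TensorTriangle.

(** * Test functions *)

Section Bump.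
Context {R : realType}.
Notation mu := (@lebesgue_measure R).

Lemma bochner_norm_fejer_le1 N q (f : R -> 'M[R[i]]_N) : 1 < q ->
  (forall s, schatten q (f s) = fejer s / (5 * pi)) ->
  (bochner_norm q f <= 1)%E.
Proof.
move=> q1 fE; have q0 : 0 < q by rewrite (lt_trans ltr01).
have pi0 := pi_gt0 R; have pi2 := @pi_ge2 R.
rewrite /bochner_norm unlock -(poweR1r q^-1).
have powE s : (`|(schatten q (f s))%:E| `^ q)%E = ((fejer s / (5 * pi)) `^ q)%:E.
  rewrite fE /= ger0_norm// divr_ge0 ?fejer_ge0//; lra.
under eq_integral do rewrite powE.
apply: gt0_ler_poweR.
- by rewrite invr_ge0 ltW.
- rewrite in_itv/= leey andbT.
  by apply: integral_ge0 => s _; rewrite lee_fin powR_ge0.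
- by rewrite in_itv/= leey andbT lee01.
apply: (@le_trans _ _ (\int[mu]_s (pi^-1 * (oneDsqr s)^-1)%:E)%E).
  apply: ge0_le_integral => //.
  - by move=> s _; rewrite lee_fin powR_ge0.
  - apply/measurable_EFinP; apply: (@measurableT_comp _ _ _ _ _ _ (fun x => x `^ q)) => //.
    apply: measurable_funM; [exact: measurable_fejer|exact: measurable_cst].
  - apply/measurable_EFinP; apply: measurable_funM; first exact: measurable_cst.
    by apply: continuous_measurable_fun; exact: continuous_oneDsqrV.
  - move=> s _; rewrite lee_fin.
    set t := fejer s / (5 * pi).
    have t0 : 0 <= t by rewrite divr_ge0 ?fejer_ge0//; lra.
    have t1 : t <= 1.
      by rewrite ler_pdivrMr; [rewrite (le_trans (fejer_le1 _))//; lra|lra].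
    apply: (@le_trans _ _ t).
      have [->|tn0] := eqVneq t 0; first by rewrite powR0// gt_eqF.
      rewrite -[leRHS]powRr1// ger_powR ?(ltW q1)// t1 andbT.
      by rewrite lt_neqAle eq_sym tn0.
    rewrite /t ler_pdivrMr; last by lra.
    rewrite (le_trans (fejer_le_oneDsqr _))// le_eqVlt; apply/orP; left; apply/eqP.
    have o0 : oneDsqr s != 0 by rewrite gt_eqF// ltr_pwDl ?sqr_ge0.
    move: (lt0r_neq0 pi0) o0; move: (oneDsqr s) (pi : R) => o p p0 o0.
    by field; rewrite o0 p0.
under eq_integral do rewrite EFinM.
rewrite ge0_integralZl_EFin//.
- by rewrite integral_oneDsqr -EFinM mulVf ?gt_eqF.
- apply/measurable_EFinP; apply: continuous_measurable_fun.
  exact: continuous_oneDsqrV.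
- by rewrite invr_ge0 ltW.
Qed.

(** The mask [msk] selects the nonzero entries, so that one construction covers both the
    column-valued and the row-valued test function. *)
Definition bump N (kappa : R) (msk : 'I_N -> 'I_N -> bool) (c : 'I_N -> 'I_N -> R)
    (xi : R) : 'M[R[i]]_N :=
  \matrix_(i, j) (kappa * tri (xi - c i j) *+ msk i j)%:C.

Definition bump_transform N (kappa : R) (msk : 'I_N -> 'I_N -> bool)
    (c : 'I_N -> 'I_N -> R) (s : R) : 'M[R[i]]_N :=
  \matrix_(i, j) ((kappa * fejer s *+ msk i j)%:C * expi (s * c i j)).

Lemma bump_cc_fourier N kappa (msk : 'I_N -> 'I_N -> bool) c :
  cc_fourier (bump_transform kappa msk c) (bump kappa msk c).
Proof.
split.
- move=> i j; split.
    under eq_fun do rewrite mxE/=.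
    move=> x; case: (msk i j); last exact: cvg_cst.
    by apply: cvgM; [exact: cvg_cst|exact: continuous_triB].
  under eq_fun do rewrite mxE/=.
  by move=> x; exact: cvg_cst.
- pose M := 1 + \sum_i \sum_j `|c i j|.
  apply: (@subclosed_compact _ _ `[- M, M]); first exact: closed_closure.
    exact: segment_compact.
  rewrite [X in _ `<=` X](closure_id _).1; last exact: itv_closed.
  apply: closureS => x /=; apply: contraNP; rewrite in_itv/= => /negP xM.
  apply/eqP/matrixP => i j; rewrite !mxE tri_eq0 ?mulr0 ?mul0rn//.
  have cM : `|c i j| <= \sum_i \sum_j `|c i j|.
    rewrite (bigD1 i)//= (bigD1 j)//= -addrA lerDl addr_ge0 ?sumr_ge0// => k _.
    by rewrite sumr_ge0.
  rewrite leNgt; apply: contra xM => xc.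
  rewrite -ler_norml /M -[x](subrK (c i j)).
  by rewrite (le_trans (ler_normD _ _))// lerD// ltW.
(* Inversion is verified off the null set {0}, where [fejer] takes its default value. *)
- exists [set 0]; split; [exact: measurable_set1|exact: lebesgue_measure_set1|].
  move=> s /=; apply: contra_notP => /eqP s0.
  apply/matrixP => i j; rewrite !mxE /cintegral.
  apply/eqP; rewrite eq_complex/=; apply/andP; split; apply/eqP.
    transitivity (\int[mu]_x (tri (x - c i j) *
        ((kappa *+ msk i j) * cos (s * x) + 0 * sin (s * x)))).
      by rewrite Rintegral_tri_trig//; case: (msk i j); rewrite ?mulr1n ?mulr0n; ring.
    apply: eq_Rintegral => x _; rewrite !mxE/=.
    by case: (msk i j); rewrite ?mulr1n ?mulr0n; ring.
  transitivity (\int[mu]_x (tri (x - c i j) *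
      (0 * cos (s * x) + (kappa *+ msk i j) * sin (s * x)))).
    by rewrite Rintegral_tri_trig//; case: (msk i j); rewrite ?mulr1n ?mulr0n; ring.
  apply: eq_Rintegral => x _; rewrite !mxE/=.
  by case: (msk i j); rewrite ?mulr1n ?mulr0n; ring.
Qed.

Lemma bump_transform_measurable N kappa (msk : 'I_N -> 'I_N -> bool) c :
  mxmeasurable (bump_transform kappa msk c).
Proof.
move=> i j.
have mk : measurable_fun setT (fun s : R => kappa * fejer s *+ msk i j).
  case: (msk i j); last exact: measurable_cst.
  by apply: measurable_funM; [exact: measurable_cst|exact: measurable_fejer].
have mx : measurable_fun setT (fun s : R => s * c i j).
  by apply: measurable_funM => //; exact: measurable_cst.
split; under eq_fun do rewrite mxE/=.
  apply: measurable_funB.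
    apply: measurable_funM => //; apply: (measurableT_comp _ mx).
    by apply: continuous_measurable_fun; exact: continuous_cos.
  under eq_fun do rewrite mul0r; exact: measurable_cst.
apply: measurable_funD.
  apply: measurable_funM => //; apply: (measurableT_comp _ mx).
  by apply: continuous_measurable_fun; exact: continuous_sin.
under eq_fun do rewrite mul0r; exact: measurable_cst.
Qed.

End Bump.

(** * The bilinear multiplier on test functions *)

Section LowerBound.
Context {R : realType}.
Notation mu := (@lebesgue_measure R).

(** On the supports of the triangles the quotient is replaced by the constant [M], for which the
    integral is explicit; as the trigonometric factor is at most 1, the cost is [c * delta]. *)
Lemma tri_quot_trig_dist (a b s c M delta A B : R) : s != 0 -> 0 <= c ->
  (forall x y, `|x - b| < 1 -> `|y - a| < 1 -> `|y / (y - x) - M| <= delta) ->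
  (forall z, `|A * cos z + B * sin z| <= 1) ->
  `|\int[mu]_x \int[mu]_y (c * (tri (x - b) * tri (y - a)) * (y / (y - x)) *
      (A * cos (s * (y + x)) + B * sin (s * (y + x)))) -
    c * M * fejer s ^+ 2 * (A * cos (s * (a + b)) + B * sin (s * (a + b)))|
  <= c * delta.
Proof.
move=> s0 c0 Md AB1.
pose t (x y : R) := A * cos (s * (y + x)) + B * sin (s * (y + x)).
have mt : measurable_fun setT (fun z : R * R => t z.1 z.2).
  have ms : measurable_fun setT (fun z : R * R => s * (z.2 + z.1)).
    apply: measurable_funM; first exact: measurable_cst.
    exact: measurable_funD.
  apply: measurable_funD; apply: measurable_funM;
    (try exact: measurable_cst); apply: (measurableT_comp _ ms);
    apply: continuous_measurable_fun; [exact: continuous_cos|exact: continuous_sin].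
(* Either the point lies in the open square where the quotient is controlled, or the weight
   vanishes. *)
have trit_eq0 x y : (`|x - b| < 1) && (`|y - a| < 1) \/
    tri (x - b) * tri (y - a) = 0.
  have [xb|xb] := ltP `|x - b| 1; last by right; rewrite tri_eq0// mul0r.
  have [ya|ya] := ltP `|y - a| 1; last by right; rewrite (tri_eq0 ya) mulr0.
  by left.
have tt0 x y : 0 <= tri (x - b) * tri (y - a) by rewrite mulr_ge0 ?tri_ge0.
rewrite -(@Rintegral12_tri_trig R a b s (c * M) A B s0).
apply: (@Rintegral12_dist R a b).
- split.
    apply: measurable_funM => //; apply: measurable_funM.
      apply: measurable_funM; first exact: measurable_cst.
      exact: measurable_tensor_tri.
    apply: measurable_funM => //; apply: (measurableT_comp measurable_invr).
    exact: measurable_funB.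
  exists (c * (delta + `|M|)) => x y; rewrite normrM -[leRHS]mulr1.
  apply: ler_pM => //.
  have [/andP[xb ya]|->] := trit_eq0 x y; last by rewrite !mulr0 mul0r normr0.
  rewrite normrM (ger0_norm (mulr_ge0 c0 (tt0 x y))) [leRHS]mulrAC.
  rewrite ler_wpM2l ?(mulr_ge0 c0 (tt0 x y))// -[y / (y - x)](subrK M).
  by rewrite (le_trans (ler_normD _ _))// lerD2r Md.
- split.
    apply: measurable_funM => //.
    apply: measurable_funM; first exact: measurable_cst.
    exact: measurable_tensor_tri.
  exists (c * `|M|) => x y; rewrite normrM -[leRHS]mulr1.
  apply: ler_pM => //.
  by rewrite normrM (ger0_norm (tt0 x y)) normrM (ger0_norm c0).
- move=> x y; rewrite -mulrBl normrM -[leRHS]mulr1.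
  apply: ler_pM => //.
  have [/andP[xb ya]|->] := trit_eq0 x y; last first.
    by rewrite !mulr0 mul0r subr0 normr0.
  rewrite (_ : _ - _ = c * (tri (x - b) * tri (y - a)) * (y / (y - x) - M));
    last by ring.
  rewrite normrM (ger0_norm (mulr_ge0 c0 (tt0 x y))) [leRHS]mulrAC.
  by rewrite ler_wpM2l ?Md//; exact: mulr_ge0 c0 (tt0 x y).
Qed.

Lemma norm_le_ReIm (z : R[i]) : `|z| <= (`|Re z| + `|Im z|)%:C.
Proof.
rewrite normc_def lecR -[leRHS]ger0_norm ?addr_ge0// -sqrtr_sqr ler_sqrt ?sqr_ge0//.
rewrite sqrrD !real_normK ?num_real// addrAC lerDl.
by rewrite mulrn_wge0// mulr_ge0.
Qed.

Lemma norm_expi (x : R) : `|expi x| = 1.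
Proof. by rewrite normc_def /= cos2Dsin2 sqrtr1. Qed.

Lemma expiD (x y : R) : expi (x + y) = expi x * expi y.
Proof.
apply/eqP; rewrite eq_complex /= cosD sinD eqxx /=.
by apply/eqP; ring.
Qed.

Lemma expi0 : expi (0 : R) = 1.
Proof. by rewrite /expi cos0 sin0. Qed.

Definition col_mask n (i j : 'I_n.+1) := j == ord0.
Definition row_mask n (i j : 'I_n.+1) := i == ord0.

Lemma bump_mulmx n kappa (a b : nat -> R) x y i j :
  (bump kappa (@col_mask n) (fun i _ => a i) y *m
   bump kappa (@row_mask n) (fun _ j => - b j) x) i j =
  (kappa ^+ 2 * (tri (x - - b j) * tri (y - a i)))%:C.
Proof.
rewrite mxE (bigD1 ord0)//= big1 ?addr0 => [|k /negbTE k0].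
  by rewrite !mxE /col_mask /row_mask eqxx !mulr1n -rmorphM; congr _%:C; ring.
by rewrite !mxE /col_mask k0 mulr0n mul0r.
Qed.

(** Entry (i, j) involves only the triangles around [a i] and [- b j]. As the centres are at
    distance at least 1 from 0, their open supports lie where [m] is given by the quotient.
    Estimating real and imaginary parts separately costs the factor 2. *)
Lemma bilinear_bump_dist n (m : R * R -> R[i]) kappa (a b : nat -> R) s
    (i j : 'I_n.+1) (M delta : R) : s != 0 ->
  (forall s t : R, 0 < s -> t < 0 -> m (s, t) = (s / (s - t))%:C) ->
  1 <= a i -> 1 <= b j ->
  (forall x y, `|x + b j| < 1 -> `|y - a i| < 1 ->
     `|y / (y - x) - M| <= delta) ->
  `|bilinear_mult m (bump kappa (@col_mask n) (fun i _ => a i))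
      (bump kappa (@row_mask n) (fun _ j => - b j)) s i j -
    (kappa ^+ 2 * M * fejer s ^+ 2)%:C * expi (s * (a i - b j))|
  <= (2 * (kappa ^+ 2 * delta))%:C.
Proof.
move=> s0 mE a1 b1 Md.
pose w x y := kappa ^+ 2 * (tri (x - - b j) * tri (y - a i)) * (y / (y - x)).
have entryE x y : ((m (y, x) * expi (s * (y + x))) *:
    (bump kappa (@col_mask n) (fun i _ => a i) y *m
     bump kappa (@row_mask n) (fun _ j => - b j) x)) i j =
    (w x y)%:C * expi (s * (y + x)).
  rewrite mxE bump_mulmx /w.
  have [xb|xb] := ltP `|x - - b j| 1; last first.
    by rewrite (tri_eq0 xb) mul0r !mulr0 mul0r mul0r.
  have [ya|ya] := ltP `|y - a i| 1; last first.
    by rewrite (tri_eq0 ya) !mulr0 mul0r mul0r.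
  rewrite mE; last 2 first.
  - by move: ya; rewrite ltr_norml => /andP[]; lra.
  - by move: xb; rewrite opprK ltr_norml => /andP[]; lra.
  by rewrite [in RHS]rmorphM/=; ring.
have Md' x y : `|x - - b j| < 1 -> `|y - a i| < 1 -> `|y / (y - x) - M| <= delta.
  by rewrite opprK; exact: Md.
have k0 : 0 <= kappa ^+ 2 by exact: sqr_ge0.
have cosb z : `|1 * cos z + 0 * sin z| <= 1 :> R.
  by rewrite mul1r mul0r addr0 cos_max.
have sinb z : `|0 * cos z + 1 * sin z| <= 1 :> R.
  by rewrite mul1r mul0r add0r sin_max.
have HR := tri_quot_trig_dist s0 k0 Md' cosb.
have HI := tri_quot_trig_dist s0 k0 Md' sinb.
apply: le_trans (norm_le_ReIm _) _; rewrite lecR mulr_natl mulr2n.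
rewrite /bilinear_mult /mxintegral mxE.
set T := cintegral _ _ _.
have TR : Re T = \int[mu]_x \int[mu]_y (w x y *
    (1 * cos (s * (y + x)) + 0 * sin (s * (y + x)))).
  rewrite /T /=; apply: eq_Rintegral => x _; rewrite mxE /=.
  apply: eq_Rintegral => y _; rewrite entryE /=; ring.
have TI : Im T = \int[mu]_x \int[mu]_y (w x y *
    (0 * cos (s * (y + x)) + 1 * sin (s * (y + x)))).
  rewrite /T /=; apply: eq_Rintegral => x _; rewrite mxE /=.
  apply: eq_Rintegral => y _; rewrite entryE /=; ring.
have RB (z z' : R[i]) : Re (z - z') = Re z - Re z' by case: z z' => ? ? [].
have IB (z z' : R[i]) : Im (z - z') = Im z - Im z' by case: z z' => ? ? [].
rewrite RB IB TR TI /=; apply: lerD.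
  apply: le_trans HR; rewrite le_eqVlt; apply/orP; left; apply/eqP.
  by congr (`|_ - _|); ring.
apply: le_trans HI; rewrite le_eqVlt; apply/orP; left; apply/eqP.
by congr (`|_ - _|); ring.
Qed.

End LowerBound.

(** * Lower bound *)

Section Final.
Context {R : realType}.

(** Trace duality against a matrix [V] of operator norm at most 4, namely [hilb] with phases
    conjugate to those of the model. The error comes from [n.+1 ^ 2] entries, each weighted by an
    entry of [V] of modulus at most 2. *)
Lemma schatten1_ge_triangular n (T : 'M[R[i]]_n.+1) (a b : nat -> R)
    (s c delta : R) : 0 <= c ->
  (forall i j, `|T i j - (c * (j <= i)%N%:R)%:C * expi (s * (a i - b j))|
     <= delta%:C) ->
  c * (n.+1%:R * half_harmonic n.+1 / 2) - 2 * n.+1%:R ^+ 2 * delta <=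
  4 * schatten 1 T.
Proof.
move=> c0 Td; pose N := n.+1.
pose e k := expi (s * b k); pose f j := expi (- (s * a j)).
pose V : 'M[R[i]]_N := \matrix_(k < N, j < N) ((hilb j k)%:C * (e k * f j)).
have e1 k : `|e k| = 1 by exact: norm_expi.
have f1 j : `|f j| = 1 by exact: norm_expi.
have trTV : `|\tr (T *m V)| <= (4 * schatten 1 T)%:C.
  by apply: norm_mxtrace_schatten1 => // x; exact: hilbert_inequality_twisted.
pose Z (i j : 'I_N) := (c * (j <= i)%N%:R)%:C * expi (s * (a i - b j)).
(* The phases of [V] cancel those of [Z], leaving a real sum over the lower triangle. *)
have ZV (i j : 'I_N) : Z i j * V j i = (c * ((j <= i)%N%:R * hilb i j))%:C.
  rewrite /Z mxE /e /f [LHS](_ : _ = (c * (j <= i)%N%:R)%:C * (hilb i j)%:C *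
     (expi (s * (a i - b j)) * expi (s * b j) * expi (- (s * a i)))); last by ring.
  rewrite -!expiD (_ : _ + _ = 0) ?expi0 ?mulr1 -?rmorphM ?mulrA//; ring.
have normV (i j : 'I_N) : `|V j i| <= 2%:C.
  rewrite mxE !normrM e1 f1 !mulr1 normc_def lecR /= expr0n/= addr0 sqrtr_sqr.
  exact: norm_hilb_le2.
have normR (x : R) : `|x%:C| = `|x|%:C.
  by rewrite normc_def /= expr0n/= addr0 sqrtr_sqr.
have H : `|(c * (\sum_(i < N) \sum_(j < N) (j <= i)%N%:R * hilb i j))%:C| <=
    (4 * schatten 1 T + 2 * N%:R ^+ 2 * delta)%:C.
  have -> : (c * (\sum_(i < N) \sum_(j < N) (j <= i)%N%:R * hilb i j))%:C =
      \tr (T *m V) - \sum_i \sum_j (T i j - Z i j) * V j i.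
    rewrite mulr_sumr rmorph_sum/= -sumrB; apply: eq_bigr => i _.
    rewrite mxE -sumrB mulr_sumr rmorph_sum/=; apply: eq_bigr => j _.
    by rewrite -ZV; ring.
  apply: le_trans (ler_normB _ _) _; rewrite rmorphD; apply: lerD => //.
  apply: le_trans (ler_norm_sum _ _ _) _.
  rewrite [leRHS](_ : _ = \sum_(i < N) \sum_(j < N) (delta%:C * 2%:C)).
    apply: ler_sum => i _; apply: le_trans (ler_norm_sum _ _ _) _.
    by apply: ler_sum => j _; rewrite normrM ler_pM.
  rewrite !sumr_const !card_ord -rmorphM -!rmorphMn; congr _%:C.
  by rewrite -mulrnA -[RHS]mulr_natl natrM; ring.
move: H; rewrite normR lecR => H; rewrite lerBlDr; apply: le_trans H.
apply: le_trans (ler_norm _).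
by rewrite ler_wpM2l// sum_lower_hilb_ge.
Qed.

(** The difference is x/(y - x), with |x| < b + 1 <= 2b and y - x > a - 1 >= a/2; the two factors 2
    account for the 4 in the hypothesis. *)
Lemma quot_dist_1 (a b x y delta : R) : 2 <= a -> 2 <= b -> 0 <= delta ->
  4 * b <= delta * a -> `|x + b| < 1 -> `|y - a| < 1 ->
  `|y / (y - x) - 1| <= delta.
Proof.
move=> a2 b2 d0 ab; rewrite !ltr_norml => /andP[x1 x2] /andP[y1 y2].
have yx : 0 < y - x by lra.
rewrite (_ : _ - 1 = x / (y - x)); last by field; rewrite gt_eqF.
rewrite normrM normfV (gtr0_norm yx) ler0_norm; last by lra.
rewrite ler_pdivrMr//; nra.
Qed.

Lemma quot_dist_0 (a b x y delta : R) : 2 <= a -> 2 <= b -> 0 <= delta ->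
  4 * a <= delta * b -> `|x + b| < 1 -> `|y - a| < 1 ->
  `|y / (y - x) - 0| <= delta.
Proof.
move=> a2 b2 d0 ab; rewrite !ltr_norml => /andP[x1 x2] /andP[y1 y2].
have yx : 0 < y - x by lra.
rewrite subr0 normrM normfV (gtr0_norm yx) ger0_norm; last by lra.
rewrite ler_pdivrMr//; nra.
Qed.

Lemma schatten_bump_col n (q kappa : R) (a : nat -> R) s : q != 0 -> 0 <= kappa ->
  schatten q (bump_transform kappa (@col_mask n) (fun i _ => a i) s) =
  kappa * Num.sqrt n.+1%:R * fejer s.
Proof.
move=> q0 k0; have kf0 : 0 <= kappa * fejer s by rewrite mulr_ge0 ?fejer_ge0.
pose u : 'cV[R[i]]_n.+1 := \col_i ((kappa * fejer s)%:C * expi (s * a i)).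
pose w : 'rV[R[i]]_n.+1 := \row_j (j == ord0)%:R.
have -> : bump_transform kappa (@col_mask n) (fun i _ => a i) s = u *m w.
  apply/matrixP => i j; rewrite !mxE big_ord1 !mxE /col_mask.
  by case: eqP => _; rewrite ?mulr1n ?mulr0n ?mulr1 ?mulr0 ?mul0r.
rewrite (@schatten_mul_col_row _ _ _ _ _ (n.+1%:R * (kappa * fejer s) ^+ 2) 1)//.
- rewrite mulr1 sqrtrM ?ler0n// sqrtr_sqr ger0_norm//; ring.
- by rewrite mulr_ge0 ?sqr_ge0.
- transitivity (\sum_(i < n.+1) ((kappa * fejer s) ^+ 2)%:C).
    apply: eq_bigr => i _; rewrite mxE normrM norm_expi mulr1.
    by rewrite normc_def/= expr0n/= addr0 sqrtr_sqr ger0_norm// -rmorphXn.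
  by rewrite sumr_const card_ord mulr_natl rmorphMn.
- rewrite (bigD1 ord0)//= big1 ?addr0 => [|i /negbTE i0].
    by rewrite mxE eqxx normr1 expr1n.
  by rewrite mxE i0 normr0 expr0n.
Qed.

Lemma schatten_bump_row n (q kappa : R) (b : nat -> R) s : q != 0 -> 0 <= kappa ->
  schatten q (bump_transform kappa (@row_mask n) (fun _ j => - b j) s) =
  kappa * Num.sqrt n.+1%:R * fejer s.
Proof.
move=> q0 k0; have kf0 : 0 <= kappa * fejer s by rewrite mulr_ge0 ?fejer_ge0.
pose u : 'cV[R[i]]_n.+1 := \col_j (j == ord0)%:R.
pose w : 'rV[R[i]]_n.+1 := \row_i ((kappa * fejer s)%:C * expi (s * - b i)).
have -> : bump_transform kappa (@row_mask n) (fun _ j => - b j) s = u *m w.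
  apply/matrixP => i j; rewrite !mxE big_ord1 !mxE /row_mask.
  by case: eqP => _; rewrite ?mulr1n ?mulr0n ?mul1r ?mul0r.
rewrite (@schatten_mul_col_row _ _ _ _ _ 1 (n.+1%:R * (kappa * fejer s) ^+ 2))//.
- rewrite mul1r sqrtrM ?ler0n// sqrtr_sqr ger0_norm//; ring.
- by rewrite mulr_ge0 ?sqr_ge0.
- rewrite (bigD1 ord0)//= big1 ?addr0 => [|i /negbTE i0].
    by rewrite mxE eqxx normr1 expr1n.
  by rewrite mxE i0 normr0 expr0n.
- transitivity (\sum_(i < n.+1) ((kappa * fejer s) ^+ 2)%:C).
    apply: eq_bigr => i _; rewrite mxE normrM norm_expi mulr1.
    by rewrite normc_def/= expr0n/= addr0 sqrtr_sqr ger0_norm// -rmorphXn.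
  by rewrite sumr_const card_ord mulr_natl rmorphMn.
Qed.

End Final.

Theorem theorem5p3 (R : realType) :
  exists C : R, 0 < C /\
    forall (m : R * R -> R[i]) (p1 p2 : R),
      csmooth_on (~` [set (0, 0)]) m ->
      homogeneous0 m ->
      (forall s t : R, 0 < s -> t < 0 -> m (s, t) = (s / (s - t))%:C) ->
      regulated0 m ->
      1 < p1 -> 1 < p2 -> p1^-1 + p2^-1 = 1 ->
      forall N : nat, (1 <= N)%N ->
        ((C * ln (N%:R : R))%:E < bilinear_mult_norm N p1 p2 m)%E.
Proof.
pose g : R := cos 1 ^+ 2; pose D : R := 5 * pi.
have g0 : 0 < g by rewrite exprn_gt0// cos1_gt0.
have D0 : 0 < D by rewrite mulr_gt0// pi_gt0.
have CC0 : 0 < g ^+ 2 / (16 * D ^+ 2).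
  apply: divr_gt0; first exact: exprn_gt0.
  by apply: mulr_gt0 => //; exact: exprn_gt0.
(* With S the half-harmonic number, the main term is at least [g ^+ 2 * S / 2] over [D ^+ 2]. Half
   of it absorbs the error because S >= 2, and the norm 4 of the dual matrix turns the remaining 1/4
   into 1/16. *)
exists (g ^+ 2 / (16 * D ^+ 2)); split => // m p1 p2 _ _ mE _ p11 p21 _ [//|n] _.
set C := g ^+ 2 / _ in CC0 *.
have lnS := @half_harmonic_gt_ln R n.+1 isT.
have S2 := @half_harmonic_ge2 R n.+1 isT.
pose N : R := n.+1%:R; have N0 : 0 < N by rewrite ltr0n.
(* Makes the Schatten norms of both test functions equal to [fejer s / D]. *)
pose kappa := (D * Num.sqrt N)^-1.
have sN0 : 0 < Num.sqrt N by rewrite sqrtr_gt0.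
have k0 : 0 < kappa by rewrite invr_gt0 mulr_gt0.
have kN : kappa ^+ 2 * N = D ^- 2.
  rewrite /kappa exprVn exprMn sqr_sqrtr ?ltW//; field.
  by rewrite !gt_eqF.
have kD : kappa * Num.sqrt N = D^-1.
  by rewrite /kappa; field; rewrite !gt_eqF.
(* With this tolerance the total error [2 * N ^+ 2 * (2 * (kappa ^+ 2 * delta))] is [g ^+ 2 / 2]
   over [D ^+ 2], free of [N]. *)
pose delta := g ^+ 2 / (8 * N).
have d0 : 0 < delta.
  by apply: divr_gt0; [exact: exprn_gt0|exact: mulr_gt0].
pose L := 4 / delta + 2.
have L2 : 2 <= L by rewrite lerDr divr_ge0 ?ltW.
have dL : 4 <= delta * L.
  by rewrite /L mulrDr mulrCA mulfV ?gt_eqF// mulr1 lerDl mulr_ge0 ?ltW.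
(* Even and odd powers interleave, so [b k] precedes [a j] exactly when k <= j. Already consecutive
   powers are separated by the required ratio 4 / [delta]. *)
pose a j := L ^+ (2 * j + 2); pose b k := L ^+ (2 * k + 1).
have Lpow k : 2 <= L ^+ k.+1.
  rewrite exprS (le_trans L2)// ler_peMr ?(le_trans _ L2)//.
  by rewrite exprn_ege1// (le_trans _ L2)// ler1n.
have Lmono k l : (k < l)%N -> 4 * L ^+ k <= delta * L ^+ l.
  move=> kl; apply: (@le_trans _ _ (delta * L ^+ k.+1)).
    by rewrite exprS mulrA ler_wpM2r// exprn_ge0// (le_trans _ L2).
  by rewrite ler_wpM2l ?(ltW d0)// ler_weXn2l// (le_trans _ L2)// ler1n.
have a2 j : 2 <= a j by rewrite /a addn2; exact: Lpow.
have b2 j : 2 <= b j by rewrite /b addn1; exact: Lpow.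
pose f1 := bump_transform kappa (@col_mask n) (fun i _ => a i).
pose f2 := bump_transform kappa (@row_mask n) (fun _ j => - b j).
pose g1 := bump kappa (@col_mask n) (fun i _ => a i).
pose g2 := bump kappa (@row_mask n) (fun _ j => - b j).
have nf1 : (bochner_norm p1 f1 <= 1)%E.
  apply: bochner_norm_fejer_le1 => // s.
  rewrite schatten_bump_col ?ltW// ?gt_eqF ?(lt_trans _ p11)//.
  by rewrite kD mulrC.
have nf2 : (bochner_norm p2 f2 <= 1)%E.
  apply: bochner_norm_fejer_le1 => // s.
  rewrite schatten_bump_row ?ltW// ?gt_eqF ?(lt_trans _ p21)//.
  by rewrite kD mulrC.
apply: (@lt_le_trans _ _ (C * half_harmonic n.+1)%:E).
  by rewrite lte_fin ltr_pM2l.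
apply: le_trans (ereal_sup_ubound _); last first.
  exists f1, f2, g1, g2; split; [split|split|split|reflexivity] => //.
  - by split; [exact: bump_transform_measurable|rewrite (le_lt_trans nf1)// ltry].
  - by split; [exact: bump_transform_measurable|rewrite (le_lt_trans nf2)// ltry].
  - exact: bump_cc_fourier.
  - exact: bump_cc_fourier.
(* It remains to bound the trace norm from below at each point of ]0, 1], an interval of measure
   1. *)
rewrite /bochner_norm Lnorm1.
have mI : measurable (`]0%R, 1%R] : set R) by exact: measurable_itv.
have C0S : 0 <= C * half_harmonic n.+1 by rewrite mulr_ge0 ?ltW// (lt_le_trans _ S2).
have := @integral_ge_cst R _ _ lebesgue_measure _
  (fun s => `|(schatten 1 (bilinear_mult m g1 g2 s))%:E|%E) _ mI C0S.
rewrite [X in (_ * X)%E](_ : _ = 1%E); last first.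
  by have := @lebesgue_measure_itv R `]0, 1]; rewrite /= lte_fin ltr01 oppr0 adde0.
rewrite mule1; apply.
  by move=> s; exact: abse_ge0.
move=> s; rewrite /= in_itv/= => s01.
have /andP[s0 s1] := s01.
rewrite lee_fin; apply: le_trans (ler_norm _).
have cF0 : 0 <= kappa ^+ 2 * fejer s ^+ 2 by rewrite mulr_ge0 ?sqr_ge0.
have Td i j : `|bilinear_mult m g1 g2 s i j -
    (kappa ^+ 2 * fejer s ^+ 2 * (j <= i)%N%:R)%:C * expi (s * (a i - b j))|
    <= (2 * (kappa ^+ 2 * delta))%:C.
  rewrite (mulrAC _ (fejer s ^+ 2)); apply: bilinear_bump_dist => //.
  - by rewrite gt_eqF.
  - by rewrite (le_trans _ (a2 i))// ler1n.
  - by rewrite (le_trans _ (b2 j))// ler1n.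
  (* On and below the diagonal [b j] is much smaller than [a i] and the symbol is close to 1; above
     it the roles are exchanged and the symbol is close to 0. *)
  - move=> x y; case: leqP => ij /=.
      apply: (quot_dist_1 (a2 i) (b2 j) (ltW d0)).
      by apply: Lmono; move: ij; clear; lia.
    apply: (quot_dist_0 (a2 i) (b2 j) (ltW d0)).
    by apply: Lmono; move: ij; clear; lia.
have := schatten1_ge_triangular cF0 Td.
set sch := schatten 1 _; set S := half_harmonic _ in S2 C0S *; rewrite -/N => H.
have F2 : g ^+ 2 <= fejer s ^+ 2.
  by rewrite lerXn2r ?nnegrE ?fejer_ge0 ?(ltW g0)//; exact: fejer_ge_cos1.
have E1 : kappa ^+ 2 * fejer s ^+ 2 * (N * S / 2) = D ^- 2 * (fejer s ^+ 2 * S / 2).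
  by rewrite -kN; ring.
have E2 : 2 * N ^+ 2 * (2 * (kappa ^+ 2 * delta)) = D ^- 2 * (g ^+ 2 / 2).
  by rewrite -kN /delta; field; rewrite gt_eqF.
rewrite E1 E2 -mulrBr in H.
have Dinv : 0 < D ^- 2 by rewrite invr_gt0 exprn_gt0.
suff : 4 * (C * S) <= D ^- 2 * (fejer s ^+ 2 * S / 2 - g ^+ 2 / 2) by lra.
have -> : 4 * (C * S) = D ^- 2 * (g ^+ 2 * S / 4).
  by rewrite /C; field; rewrite gt_eqF.
have S0 : 0 <= S by rewrite (le_trans _ S2).
have h1 := ler_wpM2r S0 F2; have h2 := ler_wpM2l (sqr_ge0 g) S2.
by rewrite ler_wpM2l ?(ltW Dinv)//; lra.
Qed.
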